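(* Let $W=\mathrm{Id}^*\circ\mathrm{Id}\colon H^2\to H^2$, where $\mathrm{Id}\colon H^2(0,1)\hookrightarrow L_2(0,1)$ is the embedding. The operator $W$ has singular values $\sigma_k^2$, $k\ge0$, with corresponding $L_2$-normalized eigenfunctions $\eta_k$, given as follows: $\sigma_0^2=\sigma_1^2=1$ with $$\eta_0(x)=1\quad\text{and}\quad\eta_1(x)=2\sqrt3\,x-\sqrt3,$$ and for $k\ge2$, $\sigma_k^2=\frac{1}{1+t_k^4}$, where $0<t_2<t_3<\dots$ are the positive solutions of $\cosh(t_k)\cos(t_k)=1$, with $$\eta_k(x)=\cosh(t_kx)+\cos(t_kx)-\frac{\cosh(t_k)-\cos(t_k)}{\sinh(t_k)-\sin(t_k)}\big(\sinh(t_kx)+\sin(t_kx)\big).$$ Further, it holds $\|\eta_0\|_\infty\le1$, $\|\eta_1\|_\infty\le\sqrt3$, and $\|\eta_k\|_\infty\le\sqrt6$ for $k\ge2$.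
   Context: $L_2=L_2(0,1)$ with Lebesgue measure. $H^2=H^2(0,1)$ is the Sobolev space of smoothness $2$ with inner product $\langle f,g\rangle_{H^2}=\langle f,g\rangle_{L_2}+\langle f'',g''\rangle_{L_2}$. $\mathrm{Id}^*$ is the Hilbert space adjoint of $\mathrm{Id}$, so $\langle W f,g\rangle_{H^2}=\langle f,g\rangle_{L_2}$ for all $f,g\in H^2$; $W$ is compact, self-adjoint and positive, and its singular values (denoted $\sigma_k^2$) coincide with its eigenvalues: $W\eta_k=\sigma_k^2\eta_k$. $\|\cdot\|_\infty$ is the supremum norm on $[0,1]$. *)

(* Defs.v *)
From HB Require Import structures.
From mathcomp Require Import all_boot all_order all_algebra.
From mathcomp Require Import all_classical all_reals all_analysis.

Set Implicit Arguments.
Unset Strict Implicit.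
Unset Printing Implicit Defensive.

Import Order.TTheory GRing.Theory Num.Theory.
Import numFieldNormedType.Exports.

Local Open Scope classical_set_scope.
Local Open Scope ring_scope.

Section Defs.
Context {R : realType}.
Implicit Types (f g phi : R -> R) (k : nat).

Definition leb01 : {measure set (measurableTypeR R) -> \bar R} :=
  mrestr (@lebesgue_measure R) (measurable_itv `]0%R, 1%R[).

(* Elements of function spaces on (0,1) are represented by functions R -> R,
   of which only the class modulo [= %[ae leb01]] is meaningful; operators are
   maps on representatives. *)
Record ip_space := IPSpace {
  carrier : set (R -> R);
  inner : (R -> R) -> (R -> R) -> R }.

Definition L2 : ip_space :=
  IPSpace [set f | f \in Lfun leb01 2%:E]
          (fun f g => \int[leb01]_x (f x * g x)).

(* C_c^oo(0,1), extended by zero *)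
Definition test_function phi : Prop :=
  (forall k x, derivable (derive1n k phi) x 1) /\
  exists a b : R, [/\ 0 < a, b < 1 & forall x, x \notin `[a, b] -> phi x = 0].

Definition weak_derivative k f g : Prop :=
  forall phi, test_function phi ->
    \int[leb01]_x (f x * derive1n k phi x) = (-1) ^+ k * \int[leb01]_x (g x * phi x).

(* a choice of the k-th weak derivative in L2, which is unique almost
   everywhere when it exists *)
Definition weakD k f : R -> R :=
  xget (cst 0) [set g | carrier L2 g /\ weak_derivative k f g].

Definition H2 : ip_space :=
  IPSpace [set f | carrier L2 f /\ forall k, (k <= 2)%N ->
                     exists2 g, carrier L2 g & weak_derivative k f g]
          (fun f g => inner L2 f g + inner L2 (weakD 2 f) (weakD 2 g)).

Definition adjoint (U V : ip_space) (A B : (R -> R) -> (R -> R)) : Prop :=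
  [/\ forall f, carrier U f -> carrier V (A f),
      forall g, carrier V g -> carrier U (B g) &
      forall f g, carrier U f -> carrier V g ->
        inner V (A f) g = inner U f (B g)].

Definition embedding : (R -> R) -> (R -> R) := id.

Definition eigen_space (U : ip_space) (A : (R -> R) -> (R -> R)) (lambda : R) :
    set (R -> R) :=
  [set f | carrier U f /\ A f = (fun x => lambda * f x) %[ae leb01]].

(* dimension modulo equality almost everywhere *)
Definition has_dim (E : set (R -> R)) (n : nat) : Prop :=
  exists e : 'I_n -> R -> R,
    [/\ forall i, E (e i),
        forall c : 'I_n -> R,
          (fun x => \sum_i c i * e i x) = cst 0 %[ae leb01] ->
          forall i, c i = 0 &
        forall f, E f -> exists c : 'I_n -> R,
          f = (fun x => \sum_i c i * e i x) %[ae leb01]].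

(* For a compact operator A on U: s lists the square roots of the eigenvalues
   of A^* A in nonincreasing order, the nonzero ones repeated according to
   multiplicity. *)
Definition singular_values (U : ip_space) (A : (R -> R) -> (R -> R))
    (s : nat -> R) : Prop :=
  exists2 B, adjoint U U A B &
    [/\ forall k, 0 <= s k,
        forall j k, (j <= k)%N -> s k <= s j &
        forall lambda, 0 < lambda -> exists2 n : nat,
          ([set k | s k = lambda] #= `I_n)%card &
          has_dim (eigen_space U (B \o A) (lambda ^+ 2)) n].

Definition sup_norm f : \bar R :=
  ereal_sup [set `|f x|%:E | x in `[0, 1]].

Definition cosh (x : R) : R := (expR x + expR (- x)) / 2.
Definition sinh (x : R) : R := (expR x - expR (- x)) / 2.

Definition sigma2 (t : nat -> R) k : R :=
  if (k < 2)%N then 1 else (1 + t k ^+ 4)^-1.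

Definition eigenfun (t : nat -> R) k : R -> R :=
  match k with
  | 0 => cst 1
  | 1 => fun x => 2 * Num.sqrt 3 * x - Num.sqrt 3
  | _ => fun x => cosh (t k * x) + cos (t k * x)
         - (cosh (t k) - cos (t k)) / (sinh (t k) - sin (t k))
           * (sinh (t k * x) + sin (t k * x))
  end.

End Defs.

(* Main.v *)
Require Import Defs.
From HB Require Import structures.
From mathcomp Require Import all_boot all_order all_algebra.
From mathcomp Require Import all_classical all_reals all_analysis.
From mathcomp Require Import measurable_realfun ring lra.

Set Implicit Arguments.
Unset Strict Implicit.
Unset Printing Implicit Defensive.

Import Order.TTheory GRing.Theory Num.Theory.
Import numFieldNormedType.Exports.

Local Open Scope classical_set_scope.
Local Open Scope ring_scope.

(** Why the theorem holds.

    For [f] in [H2], the relation [W f = l f] tested against [g] in the [H2]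
    inner product says [<g, f> = l (<g, f> + <g'', f''>)] for all [g] in [H2],
    that is [<g'', f''> = m <g, f>] with [m = l ^-1 - 1] ([eigen_spaceP]).  This
    is the weak form of [f'''' = m f] with the natural boundary conditions
    [f'' = f''' = 0] at 0 and 1, the eigenvalue problem of a free beam.

    A classical solution satisfies the weak equation by Green's formula
    ([free_mode_weak], [free_mode_eigen]).  For the converse, no regularity
    theory of Sobolev functions is used.  A function [g] with weak second
    derivative [w] satisfies Green's formula against all smooth functions that
    vanish to second order at 1, with two unknown numbers in place of the
    boundary values of [g] at 0 ([weak_green_left]).  Let [E] be the classical
    solution that has these numbers as Cauchy data at 0 and satisfies
    [E'' 0 = E''' 0 = 0].  Then [F = f - E] satisfies [<F, G''''> = m <F, G>] for
    all smooth [G] that vanish to fourth order at 1, and iterating fourfold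
    primitives, which gain a factor [1 / (4 n)!], forces [F = 0]
    ([volterra_unique]).  Testing with [1] and [x] then gives the boundary
    conditions at 1 ([weak_eigenfunction]).

    For [m = 0] the solutions are the affine functions.  For [m = t ^ 4 > 0] they
    are combinations of [cosh], [sinh], [cos] and [sin] of [t x]; the conditions
    at 0 leave two coefficients and those at 1 a linear system for them with
    determinant [2 - 2 cosh t cos t] ([free_mode_hyptrig_inv]), so a mode exists
    exactly when [cosh t cos t = 1], and it is then unique up to a factor.  Each
    interval from [j pi] to [(j + 1) pi] with [j > 0] contains exactly one such
    [t], and there is none below [pi] ([char_root_exists], [char_root_unique]).

    Since [W] is self-adjoint and nonnegative, the eigenspace of [W ^ 2] for
    [l ^ 2] is that of [W] for [l] ([eigen_space_sqr]), which gives the singular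
    values.  Modes for different [m] are orthogonal, and the first integral
    [m u ^ 2 + u'' ^ 2 - 2 u' u'''] makes the squared [L2] norm of a mode equal to
    [u 0 ^ 2 / 4 = 1] ([free_mode_norm]).  Finally, the hyperbolic part of a mode
    is at most 1 and its trigonometric part at most [sqrt (21/10)]
    ([hyptrig_bound]). *)

(** * Smooth functions on the line *)

Section Smooth.
Context {R : realType}.
Implicit Types (f g : R -> R) (x a b c : R) (A : set (R -> R)).

(** A record, and not a mere definition, so that comparing [smooth f] with
    [smooth g] never unfolds the iterated derivatives. *)
Record smooth f : Prop := Smooth {
  smooth_derivable1n : forall n x, derivable (derive1n n f) x 1 }.
Arguments smooth_derivable1n {f} _ n x.

Lemma derive1n_derive1 n f : derive1n n (derive1 f) = derive1n n.+1 f.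
Proof. by rewrite /derive1n iterSr. Qed.

Lemma derive1n_add m n f : derive1n m (derive1n n f) = derive1n (m + n) f.
Proof. by rewrite /derive1n iterD. Qed.

Lemma derive1_derive1n n f : derive1 (derive1n n f) = derive1n n.+1 f.
Proof. by []. Qed.

Lemma derive1_derive1 f : derive1 (derive1 f) = derive1n 2 f.
Proof. by []. Qed.

Lemma smooth_derivable f x : smooth f -> derivable f x 1.
Proof. by move=> sf; exact: (smooth_derivable1n sf 0%N). Qed.

Lemma smooth_derive1 f : smooth f -> smooth (derive1 f).
Proof.
by move=> sf; split=> n x; rewrite derive1n_derive1; exact: smooth_derivable1n.
Qed.

Lemma smooth_derive1n n f : smooth f -> smooth (derive1n n f).
Proof. by move=> sf; elim: n => //= n; exact: smooth_derive1. Qed.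

Lemma is_derive_derive1 f x : derivable f x 1 -> is_derive x 1 f (derive1 f x).
Proof. by move=> df; rewrite derive1E; exact: derivableP. Qed.

Lemma smooth_is_derive f x : smooth f -> is_derive x 1 f (derive1 f x).
Proof. by move=> sf; exact/is_derive_derive1/smooth_derivable. Qed.

Lemma derive1_eq f g : (forall x, is_derive x 1 f (g x)) -> derive1 f = g.
Proof. by move=> fg; apply/funext => x; rewrite derive1E; case: (fg x). Qed.

Lemma is_derive_congr f x (a b : R) : is_derive x 1 f a -> a = b -> is_derive x 1 f b.
Proof. by move=> h <-. Qed.

Inductive generated_algebra A : set (R -> R) :=
| gen_atom f of A f : generated_algebra A f
| gen_add f g of generated_algebra A f & generated_algebra A g :
    generated_algebra A (f \+ g)
| gen_mul f g of generated_algebra A f & generated_algebra A g :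
    generated_algebra A (f \* g)
| gen_cst c : generated_algebra A (cst c).

(** If every atom has its derivative in the generated algebra, the whole algebra
    is stable under differentiation, hence made of smooth functions.  Products,
    compositions with affine maps and the explicit functions below are treated by
    a suitable choice of atoms. *)
Lemma generated_algebra_smooth A :
  (forall f, A f -> exists2 g, generated_algebra A g &
     forall x, is_derive x 1 f (g x)) ->
  forall f, generated_algebra A f -> smooth f.
Proof.
move=> HA.
have step f : generated_algebra A f -> exists2 g, generated_algebra A g &
    forall x, is_derive x 1 f (g x).
  elim=> {f} [f /HA//|f g _ [f' Af' df] _ [g' Ag' dg]
             |f g Af [f' Af' df] Ag [g' Ag' dg]|c].
  - by exists (f' \+ g'); [exact: gen_add|move=> x; exact: is_deriveD].
  - exists ((f \* g') \+ (g \* f')).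
      by apply: gen_add; apply: gen_mul.
    by move=> x; exact: is_deriveM.
  - by exists (cst 0); [exact: gen_cst|move=> x; exact: is_derive_cst].
move=> f Af; split=> n x.
have [g Ag dg] : exists2 g, generated_algebra A g &
    forall x, is_derive x 1 (derive1n n f) (g x).
  elim: n => [|n [g /step[h Ah dh] dg]]; first exact: step.
  by exists h => // y; rewrite derive1nS (derive1_eq dg).
by case: (dg x).
Qed.

Lemma smooth_add f g : smooth f -> smooth g -> smooth (f \+ g).
Proof.
move=> sf sg; apply: (@generated_algebra_smooth smooth).
  move=> h sh; exists (derive1 h); last by move=> x; exact: smooth_is_derive.
  exact/gen_atom/smooth_derive1.
by apply: gen_add; apply: gen_atom.
Qed.

Lemma smooth_mul f g : smooth f -> smooth g -> smooth (f \* g).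
Proof.
move=> sf sg; apply: (@generated_algebra_smooth smooth).
  move=> h sh; exists (derive1 h); last by move=> x; exact: smooth_is_derive.
  exact/gen_atom/smooth_derive1.
by apply: gen_mul; apply: gen_atom.
Qed.

Lemma smooth_cst c : smooth (cst c : R -> R).
Proof.
by apply: (@generated_algebra_smooth set0) => //; exact: gen_cst.
Qed.

Lemma smooth_scale c f : smooth f -> smooth (fun x => c * f x).
Proof. by move=> sf; apply: (@smooth_mul (cst c)) => //; exact: smooth_cst. Qed.

Lemma smooth_lin a b f g : smooth f -> smooth g ->
  smooth (fun x => a * f x + b * g x).
Proof. by move=> sf sg; apply: smooth_add; exact: smooth_scale. Qed.

Lemma smooth_id : smooth (id : R -> R).
Proof.
apply: (@generated_algebra_smooth [set id]); last exact: gen_atom.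
by move=> _ ->; exists (cst 1); [exact: gen_cst|move=> x; exact: is_derive_id].
Qed.

Lemma smooth_primitive f g :
  (forall x, is_derive x 1 f (g x)) -> smooth g -> smooth f.
Proof.
move=> fg sg; split=> -[|n] x; first by case: (fg x).
by rewrite -derive1n_derive1 (derive1_eq fg); exact: smooth_derivable1n.
Qed.

Lemma smooth_comp_affine f a b : smooth f -> smooth (fun x => f (a * x + b)).
Proof.
move=> sf.
apply: (@generated_algebra_smooth
  [set h | exists2 g, smooth g & h = fun x => g (a * x + b)]); last first.
  by apply: gen_atom; exists f.
move=> _ [g sg ->]; exists (cst a \* (fun x => derive1 g (a * x + b))).
  apply: gen_mul; first exact: gen_cst.
  by apply: gen_atom; exists (derive1 g) => //; exact: smooth_derive1.
move=> x.
have d1 : is_derive x 1 (fun x => a * x + b) (a * 1 + 0).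
  exact: is_deriveD.
rewrite addr0 mulr1 in d1.
have d2 := smooth_is_derive (a * x + b) sg.
by apply: (is_derive_congr (@is_derive1_comp _ g (fun x => a * x + b) _ _ _ d2 d1));
  rewrite /= mulrC.
Qed.

Lemma smooth_continuous f : smooth f -> continuous f.
Proof.
move=> sf x; apply: differentiable_continuous.
exact/derivable1_diffP/smooth_derivable.
Qed.

Lemma derive1_lin a b f g : smooth f -> smooth g ->
  derive1 (fun x => a * f x + b * g x) = (fun x => a * (derive1 f) x + b * (derive1 g) x).
Proof.
move=> sf sg; apply: derive1_eq => x.
by apply: is_deriveD; apply: is_deriveZ; exact: smooth_is_derive.
Qed.

Lemma derive1n_lin n a b f g : smooth f -> smooth g ->
  derive1n n (fun x => a * f x + b * g x) =
  (fun x => a * derive1n n f x + b * derive1n n g x).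
Proof.
move=> sf sg; elim: n => // n IH.
rewrite derive1nS IH derive1_lin //; exact: smooth_derive1n.
Qed.

End Smooth.

(** * Smooth bump functions *)

Section Bump.
Context {R : realType}.

(** The derivatives of [exp (- 1 / x)], extended by 0 to the left of 0, are
    combinations of these functions; [flat 0] is the classical smooth function
    that is not analytic at 0. *)
Definition flat n (x : R) : R := if 0 < x then x ^- n * expR (- x^-1) else 0.

Lemma flat_le0 n x : x <= 0 -> flat n x = 0.
Proof. by rewrite /flat leNgt => /negbTE ->. Qed.

Lemma flat_ge0 n x : 0 <= flat n x.
Proof.
rewrite /flat; case: ifPn => // x0.
by rewrite mulr_ge0 ?expR_ge0// invr_ge0 exprn_ge0// ltW.
Qed.

Lemma flat_le1 x : flat 0 x <= 1.
Proof.
rewrite /flat; case: ifPn => // x0.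
by rewrite expr0 invr1 mul1r expR_le1 oppr_le0 invr_ge0 ltW.
Qed.

(** The exponential beats every power: this gives the derivative 0 at 0. *)
Lemma flat_bound n x : 0 < x -> flat n x <= (n.+2)`!%:R * x ^+ 2.
Proof.
move=> x0; rewrite /flat x0 expRN ler_pdivrMr ?expR_gt0//.
have := @expR_ge1Dxn _ x^-1 n.+1 (ltW _); rewrite invr_gt0 => /(_ x0) h.
have : (n.+2)`!%:R * x ^+ 2 * (x^-1 ^+ n.+2 / n.+2`!%:R) = x ^- n.
  have F0 : (n.+2)`!%:R != 0 :> R by rewrite pnatr_eq0 -lt0n fact_gt0.
  rewrite exprVn -(addn2 n) exprD; move: F0; rewrite addn2; set F := _%:R => F0.
  by field; rewrite F0 expf_neq0// lt0r_neq0.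
move=> <-; rewrite ler_pM2l; last by rewrite mulr_gt0 ?exprn_gt0// ltr0n fact_gt0.
by apply: le_trans h; rewrite lerDr.
Qed.

Lemma flat_derive n (x : R) :
  is_derive x 1 (flat n) ((- n%:R) * flat n.+1 x + flat n.+2 x).
Proof.
have [x0|x0|->] := ltgtP x 0.
- rewrite !(flat_le0 _ (ltW x0)) mulr0 addr0.
  apply: (@near_eq_is_derive _ _ _ (cst (0 : R))).
  near=> y; rewrite /= flat_le0//; apply: ltW; near: y.
  exact: lt_nbhsl.
- have xn0 : x != 0 by rewrite lt0r_neq0.
  have dV : is_derive x 1 (fun y : R => y^-1) (- x ^- 2).
    apply: (is_derive_congr (@is_deriveV _ id x 1 1 xn0 _)).
    by rewrite /= [_ *: _]mulr1.
  have dN : is_derive x 1 (fun y : R => - y^-1) (x ^- 2).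
    by apply: (is_derive_congr (is_deriveN dV)); rewrite opprK.
  have dE : is_derive x 1 (fun y : R => expR (- y^-1)) (expR (- x^-1) * x ^- 2).
    exact: (@is_derive1_comp _ expR (fun y => - y^-1) _ _ _ (is_derive_expR _) dN).
  have dX : is_derive x 1 (fun y : R => y ^- n) (- n%:R * x ^- n.+1).
    have -> : (fun y : R => y ^- n) = (fun y => y^-1) ^+ n.
      by apply/funext => y; rewrite -exprVn exprfctE.
    apply: (is_derive_congr (is_deriveX n dV)).
    rewrite /= [_ *: _]mulrC.
    case: n => [|n]; first by rewrite mulr0n oppr0 ?scale0r !mul0r ?mulr0.
    rewrite /= -mulr_natl exprVn !exprS; field.
    by rewrite expf_neq0.
  have dF : is_derive x 1 (fun y : R => y ^- n * expR (- y^-1))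
      (- n%:R * flat n.+1 x + flat n.+2 x).
    apply: (is_derive_congr (is_deriveM dX dE)).
    rewrite /flat x0 /= /GRing.scale/= !exprS; field.
    by rewrite expf_neq0.
  apply: (near_eq_is_derive _ dF); near=> y.
  by rewrite /flat ifT//; near: y; exact: lt_nbhsr.
- rewrite !flat_le0// mulr0 addr0.
  have cv : h^-1 *: ((flat n \o shift 0) (h *: 1) - flat n 0) @[h --> 0^'] --> (0:R).
    apply/cvgrPdist_le => e e0; near=> h.
    rewrite /= sub0r normrN addr0 (flat_le0 _ (lexx _)) subr0 [h *: 1]mulr1.
    rewrite [_ *: _]/(_ * _) normrM normfV.
    have hn0 : h != 0 by near: h; exact: nbhs_dnbhs_neq.
    have [h0|h0] := leP h 0; first by rewrite flat_le0// normr0 mulr0 ltW.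
    rewrite (ger0_norm (flat_ge0 _ _)) (gtr0_norm h0) ler_pdivrMl//.
    apply: le_trans (flat_bound _ h0) _.
    rewrite expr2 mulrA mulrC ler_pM2l// -ler_pdivlMl ?ltr0n ?fact_gt0//.
    rewrite -(gtr0_norm h0); near: h.
    have : 0 < (n.+2`!%:R)^-1 * e by rewrite mulr_gt0// invr_gt0 ltr0n fact_gt0.
    move=> d0; apply: dnbhs0_le => //.
  apply: DeriveDef; first by apply/cvg_ex; exists 0.
  by apply/cvg_lim => //.
Unshelve. all: by end_near. Qed.

Lemma smooth_flat : smooth (flat 0).
Proof.
apply: (@generated_algebra_smooth _ [set f | exists n, f = flat n]); last first.
  by apply: gen_atom; exists 0%N.
move=> _ [n ->]; exists ((cst (- n%:R) \* flat n.+1) \+ flat n.+2).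
  apply: gen_add; last by apply: gen_atom; exists n.+2.
  by apply: gen_mul; [exact: gen_cst|apply: gen_atom; exists n.+1].
by move=> x; exact: flat_derive.
Qed.

(** As [c] grows, this converges to the indicator of the open interval from [a] to
    [b] while staying between 0 and 1, which suits dominated convergence. *)
Definition bump (a b c x : R) : R :=
  flat 0 (c * x + - (c * a)) * flat 0 ((- c) * x + c * b).

Lemma smooth_bump a b c : smooth (bump a b c).
Proof. by apply: smooth_mul; apply: (smooth_comp_affine (f := flat 0)); exact: smooth_flat. Qed.

Lemma bump_ge0 a b c x : 0 <= bump a b c x.
Proof. by rewrite mulr_ge0 ?flat_ge0. Qed.

Lemma bump_le1 a b c x : bump a b c x <= 1.
Proof. by rewrite mulr_ile1 ?flat_ge0 ?flat_le1. Qed.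

Lemma bump_out a b c x : 0 <= c -> x \notin `]a, b[ -> bump a b c x = 0.
Proof.
move=> c0; rewrite in_itv/= negb_and -!leNgt => /orP[xa|bx]; rewrite /bump.
  by rewrite flat_le0 ?mul0r// -mulrBr mulr_ge0_le0// subr_le0.
by rewrite (@flat_le0 _ (_ + c * b)) ?mulr0// mulNr addrC -mulrBr mulr_ge0_le0// subr_le0.
Qed.

Lemma test_bump a b c : 0 < a -> b < 1 -> 0 <= c -> test_function (bump a b c).
Proof.
move=> a0 b1 c0; split; first exact/smooth_derivable1n/smooth_bump.
exists a, b; split => // x xab; rewrite bump_out//.
by apply: contra xab; exact: subset_itv_oo_cc.
Qed.

Lemma cvg_flat (u : nat -> R) : u @ \oo --> +oo -> flat 0 (u n) @[n --> \oo] --> (1 : R).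
Proof.
move=> cu.
have : expR (- (u n)^-1) @[n --> \oo] --> expR (- 0 : R).
  apply: (cvg_comp (fun n => - (u n)^-1) expR); last exact: continuous_expR.
  apply: cvgN; apply/gtr0_cvgV0 => //.
  by move/cvgryPgt : cu; exact.
rewrite oppr0 expR0; apply: cvg_trans; apply: near_eq_cvg; near=> n.
rewrite /flat ifT ?expr0 ?invr1 ?mul1r//.
by near: n; move/cvgryPgt : cu; exact.
Unshelve. all: by end_near. Qed.

End Bump.

(** * Integration over the unit interval *)

(** Locked because a failed comparison of two such integrals would otherwise
    unfold the Lebesgue integral. *)
HB.lock Definition I01 {R : realType} (f : R -> R) : R := \int[leb01]_x f x.

Section UnitIntervalMeasure.
Context {R : realType}.
Implicit Types (f g h : R -> R) (a b c x : R).
Local Notation mu := (@lebesgue_measure R).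
Local Notation D01 := (`]0%R, 1%R[%classic : set R).

Lemma I01_def f : I01 f = \int[leb01]_x f x.
Proof. by rewrite I01.unlock. Qed.

Definition intg f := (@leb01 R).-integrable setT (EFin \o f).

Let mD : measurable (D01 : set (measurableTypeR R)).
Proof. exact: measurable_itv. Qed.

#[global] Instance ae_leb01_filter : Filter (nbhs (almost_everywhere (@leb01 R))).
Proof. exact: (ae_filter_ringOfSetsType (@leb01 R)). Qed.

#[global] Instance ae_lebesgue_filter :
  Filter (nbhs (almost_everywhere (@lebesgue_measure R))).
Proof. exact: (ae_filter_ringOfSetsType (@lebesgue_measure R)). Qed.

Lemma leb01E (A : set R) : @leb01 R A = mu (A `&` D01).
Proof. by []. Qed.

Lemma weak_derivativeP n f g : weak_derivative n f g <->
  forall phi, test_function phi ->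
  I01 (fun x => f x * derive1n n phi x) = (-1) ^+ n * I01 (fun x => g x * phi x).
Proof. by split=> fg phi /fg; rewrite !I01_def. Qed.

Lemma innerL2E f g : inner L2 f g = I01 (fun x => f x * g x).
Proof. by rewrite I01_def. Qed.

Lemma ae_unit_itv : \forall x \ae @leb01 R, D01 x.
Proof.
apply/negligibleP; first exact: measurableC.
by rewrite [LHS]leb01E setICl measure0.
Qed.

Lemma ae_lebesgue_leb01 (P : R -> Prop) :
  (\forall x \ae mu, D01 x -> P x) -> \forall x \ae @leb01 R, P x.
Proof.
move=> [A [mA A0 PA]].
have h : \forall x \ae @leb01 R, D01 x -> P x.
  exists A; split => //; rewrite [LHS]leb01E.
  by apply: (subset_measure0 _ _ (@subIsetl _ A D01)) => //; exact: measurableI.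
by apply: filterS2 ae_unit_itv h => x xD; apply.
Qed.

Lemma leb01T : @leb01 R setT = 1%E.
Proof.
by rewrite leb01E setTI lebesgue_measure_itv/= lte_fin ltr01 oppr0 adde0.
Qed.

Lemma ereal_int01E (F : R -> \bar R) : measurable_fun setT F ->
  (\int[leb01]_x F x = \int[mu]_(x in D01) F x)%E.
Proof.
move=> mF; rewrite -(setvU D01) integral_setU//=; last 3 first.
- exact: measurableC.
- by rewrite setvU.
- by apply/disj_setPLR.
rewrite null_set_integral ?add0e//; last 3 first.
- exact: measurableC.
- exact: measurable_funS mF.
- by rewrite [LHS]leb01E setICl measure0.
apply: eq_measure_integral => A mA AD.
by rewrite leb01E setIidl.
Qed.

Lemma intgP f : intg f <->
  measurable_fun setT f /\ mu.-integrable D01 (EFin \o f).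
Proof.
split=> [/integrableP[/measurable_EFinP mf fi]|[mf /integrableP[_ fi]]].
  split => //; apply/integrableP; split.
    by apply/measurable_EFinP; exact: measurable_funS mf.
  rewrite -ereal_int01E//; apply: measurableT_comp => //.
  exact/measurable_EFinP.
apply/integrableP; split; first exact/measurable_EFinP.
rewrite ereal_int01E//; apply: measurableT_comp => //.
exact/measurable_EFinP.
Qed.

Lemma intg_measurable f : intg f -> measurable_fun setT f.
Proof. by move=> /intgP[]. Qed.

Lemma I01E f : measurable_fun setT f -> I01 f = \int[mu]_(x in D01) f x.
Proof.
move=> mf; rewrite !I01_def /Rintegral ereal_int01E//; exact/measurable_EFinP.
Qed.

Lemma I01_ae_eq f g : measurable_fun setT f -> measurable_fun setT g ->
  f = g %[ae leb01] -> I01 f = I01 g.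
Proof.
move=> mf mg fg; rewrite !I01_def; congr fine; apply: ae_eq_integral => //.
- exact/measurable_EFinP.
- exact/measurable_EFinP.
- by apply: filterS fg => x h _; rewrite h.
Qed.

Lemma ae_eq_on01 f g : (forall x, 0 < x < 1 -> f x = g x) -> f = g %[ae leb01].
Proof.
move=> fg; apply: filterS ae_unit_itv => x /=; rewrite in_itv/= => xD _.
exact: fg.
Qed.

Lemma intg_scale c f : intg f -> intg (fun x => c * f x).
Proof. by move=> fi; exact: (integrableZl measurableT c fi). Qed.

Lemma I01_lin a b f g : intg f -> intg g ->
  I01 (fun x => a * f x + b * g x) = a * I01 f + b * I01 g.
Proof.
move=> fi gi.
have afi := intg_scale a fi; have bgi := intg_scale b gi.
by rewrite !I01_def RintegralD// !RintegralZl.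
Qed.

Lemma intg_lin a b f g : intg f -> intg g -> intg (fun x => a * f x + b * g x).
Proof.
move=> fi gi.
have afi := intg_scale a fi; have bgi := intg_scale b gi.
exact: (integrableD measurableT afi bgi).
Qed.

Lemma I01_add f g : intg f -> intg g ->
  I01 (fun x => f x + g x) = I01 f + I01 g.
Proof. by move=> fi gi; rewrite !I01_def RintegralD. Qed.

Lemma intg_norm f : intg f -> intg (fun x => `|f x|).
Proof. by move=> fi; exact: (integrable_norm fi). Qed.

Lemma norm_I01 f : intg f -> `|I01 f| <= I01 (fun x => `|f x|).
Proof. by move=> fi; rewrite !I01_def; exact: le_normr_Rintegral. Qed.

Lemma le_I01 f g : intg f -> intg g -> (forall x, 0 < x < 1 -> f x <= g x) ->
  I01 f <= I01 g.
Proof.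
move=> fi gi fg; rewrite !I01E; [|exact: intg_measurable..].
by apply: le_Rintegral => //; [case/intgP: fi|case/intgP: gi].
Qed.

Lemma I01_cst c : I01 (cst c) = c.
Proof. by rewrite !I01_def Rintegral_cst// leb01T/= mulr1. Qed.

Lemma intg_bounded f M : measurable_fun setT f ->
  (forall x, 0 < x < 1 -> `|f x| <= M) -> intg f.
Proof.
move=> mf fM; apply/intgP; split => //.
apply: measurable_bounded_integrable => //.
- by rewrite /= lebesgue_measure_itv/= lte_fin ltr01 oppr0 adde0 ltry.
- exact: measurable_funS mf.
- exists M; split; first exact: num_real.
  move=> y My x /=; rewrite in_itv/= => /fM fxM; exact: le_trans fxM (ltW My).
Qed.

Lemma continuous_bounded01 f : continuous f ->
  exists2 M, 0 <= M & forall x, 0 <= x <= 1 -> `|f x| <= M.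
Proof.
move=> cf.
have cf' : {within `[0, 1]%classic, continuous (fun x => `|f x|)}.
  apply: continuous_subspaceT => x; apply: continuous_comp; first exact: cf.
  exact: norm_continuous.
have [c _ cM] := EVT_max (@ler01 R) cf'.
exists `|f c|; first exact: normr_ge0.
by move=> x x01; apply: cM; rewrite in_itv.
Qed.

Lemma intg_continuous f : continuous f -> intg f.
Proof.
move=> cf; have [M _ fM] := continuous_bounded01 cf.
apply: (@intg_bounded _ M); first exact: continuous_measurable_fun.
by move=> x /andP[x0 x1]; apply: fM; rewrite !ltW.
Qed.

Lemma intg_mul_bounded f g M : intg f -> measurable_fun setT g ->
  (forall x, 0 < x < 1 -> `|g x| <= M) -> intg (fun x => f x * g x).
Proof.
move=> fi mg gM; have mf := intg_measurable fi.
apply/intgP; split; first exact: measurable_funM.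
case/intgP : fi => _ fi.
apply: (@le_integrable _ _ _ mu _ mD _ (fun x => (M * f x)%:E)).
- by apply/measurable_EFinP/measurable_funM; [exact: measurable_funS mf|exact: measurable_funS mg].
- move=> x /=; rewrite in_itv/= => xD.
  rewrite lee_fin !normrM mulrC ler_wpM2r//.
  by apply: (le_trans (gM _ xD)); exact: ler_norm.
- exact: (integrableZl mD M fi).
Qed.

Lemma intg_mul_continuous f g : intg f -> continuous g ->
  intg (fun x => f x * g x).
Proof.
move=> fi cg; have [M _ gM] := continuous_bounded01 cg.
apply: (@intg_mul_bounded _ _ M) => //; first exact: continuous_measurable_fun.
by move=> x /andP[x0 x1]; apply: gM; rewrite !ltW.
Qed.

Lemma I01_dominated (u : nat -> R -> R) (f g : R -> R) :
  (forall n, measurable_fun setT (u n)) -> measurable_fun setT f -> intg g ->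
  (forall x, 0 < x < 1 -> u n x @[n --> \oo] --> f x) ->
  (forall n x, 0 < x < 1 -> `|u n x| <= g x) ->
  I01 (u n) @[n --> \oo] --> I01 f.
Proof.
move=> mu_ mf gi uf ug.
have [] := @dominated_convergence _ _ _ (@leb01 R) setT measurableT
  (fun n => EFin \o u n) (EFin \o f) (EFin \o g).
- by move=> n; apply/measurable_EFinP; exact: mu_.
- exact/measurable_EFinP.
- apply: filterS ae_unit_itv => x /=; rewrite in_itv/= => xD _.
  by apply: cvg_EFin; [exact: nearW|exact: uf].
- exact: gi.
- apply: filterS ae_unit_itv => x /=; rewrite in_itv/= => xD n _.
  by rewrite lee_fin; exact: ug.
move=> fi _ uif; under eq_fun do rewrite I01_def.
apply: fine_cvg; rewrite I01_def /Rintegral fineK//.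
exact: integrable_fin_num.
Qed.

Lemma L2_intg_mul f g : carrier L2 f -> carrier L2 g -> intg (fun x => f x * g x).
Proof. by move=> fL gL; apply/Lfun1_integrable; exact: Lfun2_mul_Lfun1. Qed.

Lemma L2_measurable f : carrier L2 f -> measurable_fun setT f.
Proof. by move=> /sub_Lfun_mfun; rewrite inE. Qed.

Lemma L2P f : carrier L2 f <-> measurable_fun setT f /\ intg (fun x => f x ^+ 2).
Proof.
split=> [fL|[mf fi]].
  by split; [exact: L2_measurable|exact: Lfun2_integrable_sqr].
rewrite /=; apply/andP; split; first by rewrite inE.
rewrite inE /= /finite_norm unlock /Lnorm.
rewrite poweR_lty//.
case/integrableP : fi => _; congr (_ < _)%E.
apply: eq_integral => x _ /=; congr _%:E.
by rewrite powR_mulrn ?normr_ge0// normrX.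
Qed.

Lemma L2_continuous f : continuous f -> carrier L2 f.
Proof.
move=> cf; apply/L2P; split; first exact: continuous_measurable_fun.
by apply: intg_continuous => x; exact: (cvgM (cf x) (cf x)).
Qed.

Lemma L2_intg f : carrier L2 f -> intg f.
Proof.
move=> fL; have := L2_intg_mul fL (@L2_continuous (cst 1) (@cst_continuous _ _ _)).
by apply: eq_integrable => // x _ /=; rewrite mulr1.
Qed.

Lemma L2_lin a b f g : carrier L2 f -> carrier L2 g ->
  carrier L2 (fun x => a * f x + b * g x).
Proof.
move=> fL gL.
have mf := L2_measurable fL; have mg := L2_measurable gL.
apply/L2P; split.
  by apply: measurable_funD; exact: measurable_funM.
pose h x := a ^+ 2 * (f x * f x) + (2 * a * b) * (f x * g x).
have hi : intg (fun x => 1 * h x + b ^+ 2 * (g x * g x)).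
  by apply: intg_lin; [apply: intg_lin|]; exact: L2_intg_mul.
by apply: eq_integrable hi => // x _ /=; congr _%:E; rewrite /h; ring.
Qed.

Lemma L2_I01_linr a b f g h : carrier L2 f -> carrier L2 g -> carrier L2 h ->
  I01 (fun x => f x * (a * g x + b * h x)) =
  a * I01 (fun x => f x * g x) + b * I01 (fun x => f x * h x).
Proof.
move=> fL gL hL.
have -> : (fun x => f x * (a * g x + b * h x)) =
    (fun x => a * (f x * g x) + b * (f x * h x)) by apply/funext => x; ring.
by rewrite I01_lin//; exact: L2_intg_mul.
Qed.

Lemma I01_mulC f g : I01 (fun x => f x * g x) = I01 (fun x => g x * f x).
Proof. by congr I01; apply/funext => x; rewrite mulrC. Qed.

Lemma L2_I01_linl a b f g h : carrier L2 f -> carrier L2 g -> carrier L2 h ->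
  I01 (fun x => (a * g x + b * h x) * f x) =
  a * I01 (fun x => g x * f x) + b * I01 (fun x => h x * f x).
Proof.
by move=> fL gL hL; rewrite I01_mulC L2_I01_linr// !(I01_mulC f).
Qed.

Lemma L2_I01_mulr a f g : carrier L2 f -> carrier L2 g ->
  I01 (fun x => f x * (a * g x)) = a * I01 (fun x => f x * g x).
Proof.
move=> fL gL; have := L2_I01_linr a 0 fL gL gL; rewrite mul0r addr0 => <-.
by congr I01; apply/funext => x; rewrite mul0r addr0.
Qed.

Lemma L2_I01_aer f g h : carrier L2 f -> carrier L2 g -> carrier L2 h ->
  g = h %[ae leb01] -> I01 (fun x => f x * g x) = I01 (fun x => f x * h x).
Proof.
move=> fL gL hL gh; apply: I01_ae_eq.
- by apply: intg_measurable; exact: L2_intg_mul.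
- by apply: intg_measurable; exact: L2_intg_mul.
- by apply: filterS gh => x /(_ I) ->.
Qed.

Lemma L2_I01_ael f g h : carrier L2 f -> carrier L2 g -> carrier L2 h ->
  g = h %[ae leb01] -> I01 (fun x => g x * f x) = I01 (fun x => h x * f x).
Proof.
by move=> fL gL hL gh; rewrite I01_mulC (L2_I01_aer fL gL hL gh) I01_mulC.
Qed.

Lemma L2_I01_mull a f g : carrier L2 f -> carrier L2 g ->
  I01 (fun x => (a * f x) * g x) = a * I01 (fun x => f x * g x).
Proof.
by move=> fL gL; rewrite I01_mulC (L2_I01_mulr _ gL fL) I01_mulC.
Qed.

Lemma I01_sqr_eq0 f : carrier L2 f -> I01 (fun x => f x * f x) = 0 ->
  f = cst 0 %[ae leb01].
Proof.
move=> fL; rewrite !I01_def /Rintegral => f0.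
have fi := L2_intg_mul fL fL.
have mf := intg_measurable fi.
have I0 : (\int[leb01]_x `|(f x * f x)%:E| = 0)%E.
  rewrite -[RHS]/(0%:E) -f0 fineK; last exact: integrable_fin_num.
  by apply: eq_integral => x _; rewrite gee0_abs// lee_fin -expr2 sqr_ge0.
have mff : measurable_fun setT (fun x => (f x * f x)%:E) by exact/measurable_EFinP.
have H := (ae_eq_integral_abs leb01 measurableT mff).1 I0.
by apply: filterS H => x /(_ I) [] /eqP; rewrite -expr2 sqrf_eq0 => /eqP.
Qed.

End UnitIntervalMeasure.

(** * Fundamental theorem of calculus and integration by parts *)

Section Calculus.
Context {R : realType}.
Implicit Types (f g h phi F : R -> R) (a b c x y : R).
Local Notation mu := (@lebesgue_measure R).

Lemma is_derive_continuous F f :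
  (forall x, is_derive x 1 F (f x)) -> continuous F.
Proof.
move=> Ff x; apply: differentiable_continuous.
by apply/derivable1_diffP; case: (Ff x).
Qed.

Lemma le_of_derive F f a b : (forall x, is_derive x 1 F (f x)) -> a <= b ->
  (forall x, a < x < b -> 0 <= f x) -> F a <= F b.
Proof.
move=> Ff ab f0; rewrite le_eqVlt in ab; case/predU1P: ab => [->//|ab].
have [c] := MVT ab (fun x _ => Ff x)
  (continuous_subspaceT (is_derive_continuous Ff)).
rewrite in_itv/= => cab E.
by rewrite -subr_ge0 E mulr_ge0 ?subr_ge0 ?f0// ltW.
Qed.

Lemma FTC01 F f : (forall x, is_derive x 1 F (f x)) -> continuous f ->
  I01 f = F 1 - F 0.
Proof.
move=> Ff cf; rewrite I01E; last exact: continuous_measurable_fun.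
have cF := is_derive_continuous Ff.
have fi : mu.-integrable `[0, 1] (EFin \o f).
  apply: continuous_compact_integrable; first exact: segment_compact.
  exact: continuous_subspaceT.
rewrite Rintegral_itv_bndo_bndc; last first.
  by apply: integrableS fi => //; exact: subset_itv_oo_cc.
rewrite Rintegral_itv_obnd_cbnd; last first.
  by apply: integrableS fi => //; exact: subset_itv_oc_cc.
rewrite /Rintegral (@continuous_FTC2 _ f F)//.
- exact: continuous_subspaceT.
- split.
  + by move=> x _; case: (Ff x).
  + by apply: cvg_at_right_filter; exact: cF.
  + by apply: cvg_at_left_filter; exact: cF.
- by move=> x _; rewrite derive1E; case: (Ff x).
Qed.

Let Q h a x := \int[mu]_(t in `[a, x]) h t.

Let Q_int h a x : continuous h -> mu.-integrable `[a, x] (EFin \o h).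
Proof.
move=> ch; apply: continuous_compact_integrable; first exact: segment_compact.
exact: continuous_subspaceT.
Qed.

Let Q_split h a b x : continuous h -> a <= b -> b <= x ->
  Q h a x = Q h a b + Q h b x.
Proof.
move=> ch ab bx.
have := @Rintegral_itvB _ h (BLeft a) (BRight x) b (Q_int a x ch).
rewrite !bnd_simp => /(_ ab bx) /eqP; rewrite subr_eq addrC => /eqP.
rewrite Rintegral_itv_obnd_cbnd//; apply: integrableS (Q_int b x ch) => //.
exact: subset_itv_oc_cc.
Qed.

Let Q_derive h a x : continuous h -> a < x -> is_derive x 1 (Q h a) (h x).
Proof.
move=> ch ax.
have [|dQ Qh] := @continuous_FTC1_closed _ h a x (x + 1) _ (Q_int a _ ch) ax (ch x).
  by rewrite ltrDl.
by rewrite -Qh; exact: is_derive_derive1.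
Qed.

(** The integral of [h] from a base point [a] has the required derivative only to
    the right of [a].  Moving the base point changes that integral by a
    constant, so a base point that depends on [x] gives a primitive on the
    whole line. *)
Lemma ex_primitive h : continuous h ->
  exists2 P : R -> R, P 1 = 0 & forall x, is_derive x 1 P (h x).
Proof.
move=> ch.
pose m x := - (`|x| + 1).
have mlt x : m x < x /\ m x < 0.
  rewrite /m; split; last by rewrite oppr_lt0 ltr_pwDr.
  by rewrite ltrNl (le_lt_trans (ler_norm _))// normrN ltrDl.
pose P0 x := Q h (m x) x - Q h (m x) 0.
have P0E a x : a <= m x -> P0 x = Q h a x - Q h a 0.
  move=> am; have [m1 m2] := mlt x.
  rewrite /P0 (Q_split ch am (ltW m1)) (Q_split ch am (ltW m2)).
  by rewrite opprD addrACA subrr add0r.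
have dP0 x : is_derive x 1 P0 (h x).
  pose a := - (`|x| + 2).
  have ax : a < x.
    by rewrite /a ltrNl (le_lt_trans (ler_norm _))// normrN ltrDl.
  have dQ : is_derive x 1 (fun y => Q h a y - Q h a 0) (h x).
    apply: (is_derive_congr (is_deriveB (Q_derive ch ax) (is_derive_cst _ _ _))).
    by rewrite subr0.
  apply: (near_eq_is_derive _ dQ); near=> y; rewrite (P0E a)//.
  rewrite /a /m lerN2 (_ : 2 = 1 + 1) // addrA lerD2r -lerBlDl.
  apply: (le_trans (lerB_dist _ _)); rewrite distrC.
  near: y; exact: cvgr_dist_le.
exists (fun x => P0 x - P0 1); first by rewrite subrr.
move=> x; apply: (is_derive_congr (is_deriveB (dP0 x) (is_derive_cst _ _ _))).
by rewrite subr0.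
Unshelve. all: by end_near. Qed.

Lemma L2_smooth f : smooth f -> carrier L2 f.
Proof. by move=> /smooth_continuous/L2_continuous. Qed.

Lemma smooth_ibp f g : smooth f -> smooth g ->
  I01 (fun x => f x * derive1 g x) =
  f 1 * g 1 - f 0 * g 0 - I01 (fun x => derive1 f x * g x).
Proof.
move=> sf sg.
have cf := smooth_continuous sf; have cg := smooth_continuous sg.
have cf' := smooth_continuous (smooth_derive1 sf).
have cg' := smooth_continuous (smooth_derive1 sg).
have c1 : continuous (fun x => f x * derive1 g x).
  by move=> x; exact: (cvgM (cf x) (cg' x)).
have c2 : continuous (fun x => derive1 f x * g x).
  by move=> x; exact: (cvgM (cf' x) (cg x)).
apply/eqP; rewrite eq_sym subr_eq -[X in _ == X]/(_ + _) eq_sym; apply/eqP.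
rewrite -I01_add; [|exact: intg_continuous..].
apply: (@FTC01 (f \* g)).
  move=> x; apply: (is_derive_congr
    (is_deriveM (smooth_is_derive x sf) (smooth_is_derive x sg))).
  by rewrite /GRing.scale/= [derive1 f x * _]mulrC.
by move=> x; apply: cvgD; [exact: c1|exact: c2].
Qed.

Lemma smooth_ibp2 f g : smooth f -> smooth g ->
  I01 (fun x => f x * derive1n 2 g x) =
  (f 1 * derive1 g 1 - derive1 f 1 * g 1) -
  (f 0 * derive1 g 0 - derive1 f 0 * g 0) +
  I01 (fun x => derive1n 2 f x * g x).
Proof.
move=> sf sg; rewrite (smooth_ibp sf (smooth_derive1 sg)).
rewrite (smooth_ibp (smooth_derive1 sf) sg).
rewrite -!derive1_derive1; move: (I01 _) => p; ring.
Qed.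

Lemma test_functionP phi : test_function phi <-> smooth phi /\
  exists a b : R, [/\ 0 < a, b < 1 & forall x, x \notin `[a, b] -> phi x = 0].
Proof.
split=> -[sp ab]; split; [exact: Smooth sp|exact: ab| |exact: ab].
exact: smooth_derivable1n sp.
Qed.

Lemma test_smooth phi : test_function phi -> smooth phi.
Proof. by case/test_functionP. Qed.

Lemma test_derive1 phi : test_function phi -> test_function (derive1 phi).
Proof.
move=> /test_functionP[sp [a [b [a0 b1 pab]]]].
apply/test_functionP; split; first exact: smooth_derive1.
exists a, b; split => // x xab; rewrite derive1E; apply: derive_val.
apply: (@near_eq_is_derive _ R R (cst 0)).
move: xab; rewrite in_itv/= negb_and -!ltNge => /orP[xa|bx]; near=> y.
  rewrite pab//= in_itv/= negb_and -!ltNge; apply/orP; left.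
  by near: y; exact: lt_nbhsl.
rewrite pab//= in_itv/= negb_and -!ltNge; apply/orP; right.
by near: y; exact: lt_nbhsr.
Unshelve. all: by end_near. Qed.

Lemma test_derive1n n phi : test_function phi -> test_function (derive1n n phi).
Proof. by move=> tp; elim: n => // n; exact: test_derive1. Qed.

Lemma test_at0 phi : test_function phi -> phi 0 = 0.
Proof.
by move=> [_ [a [b [a0 b1 ->]]]]//; rewrite in_itv/= negb_and -!ltNge a0.
Qed.

Lemma test_at1 phi : test_function phi -> phi 1 = 0.
Proof.
by move=> [_ [a [b [a0 b1 ->]]]]//; rewrite in_itv/= negb_and -!ltNge b1 orbT.
Qed.

Lemma smooth_weak_derivative n f : smooth f -> weak_derivative n f (derive1n n f).
Proof.
move=> sf; apply/weak_derivativeP => phi.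
elim: n f phi sf => [|n IH] f phi sf tp; first by rewrite expr0 mul1r.
have tn := test_derive1n n tp.
rewrite -derive1_derive1n (smooth_ibp sf (test_smooth tn)).
rewrite (test_at0 tn) (test_at1 tn) !mulr0 subrr sub0r.
rewrite (IH (derive1 f) phi (smooth_derive1 sf) tp).
by rewrite derive1n_derive1 exprS mulN1r mulNr.
Qed.

End Calculus.

(** * The fundamental lemma of the calculus of variations *)

Section FundamentalLemma.
Context {R : realType}.
Implicit Types (f g h phi u : R -> R) (a b c x y : R).
Local Notation mu := (@lebesgue_measure R).
Local Notation D01 := (`]0%R, 1%R[%classic : set R).

Lemma test_lin a b f g : test_function f -> test_function g ->
  test_function (fun x => a * f x + b * g x).
Proof.
move=> /test_functionP[sf [a1 [b1 [a10 b11 f0]]]].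
move=> /test_functionP[sg [a2 [b2 [a20 b21 g0]]]].
apply/test_functionP; split; first exact: smooth_lin.
exists (Num.min a1 a2), (Num.max b1 b2); split.
- by rewrite lt_min a10.
- by rewrite gt_max b11.
- move=> x; rewrite in_itv/= negb_and -!ltNge lt_min gt_max => H.
  rewrite f0 ?g0 ?mulr0 ?addr0// in_itv/= negb_and -!ltNge.
  + by case/orP: H => /andP[? ->]; rewrite ?orbT.
  + by case/orP: H => /andP[-> ?]; rewrite ?orbT.
Qed.

Lemma test_mul f phi : smooth f -> test_function phi ->
  test_function (fun x => f x * phi x).
Proof.
move=> sf /test_functionP[sp [a [b [a0 b1 p0]]]].
apply/test_functionP; split; first exact: smooth_mul.
by exists a, b; split => // x /p0 ->; rewrite mulr0.
Qed.

Let cvg_natMy c : 0 < c -> n%:R * c @[n --> \oo] --> +oo.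
Proof.
move=> c0; apply/cvgryPge => A; near=> n; rewrite -ler_pdivrMr//.
by near: n; exact: nbhs_infty_ger.
Unshelve. all: by end_near. Qed.

Lemma cvg_bump a b x : a < x < b ->
  bump a b n%:R x @[n --> \oo] --> (1 : R).
Proof.
move=> /andP[ax xb]; rewrite -[X in _ --> X](mulr1 1).
apply: cvgM.
  apply: (cvg_flat (u := fun n => n%:R * x + - (n%:R * a))).
  have -> : (fun n => n%:R * x - n%:R * a) = (fun n => n%:R * (x - a)).
    by apply/funext => n; rewrite mulrBr.
  by apply: cvg_natMy; rewrite subr_gt0.
apply: (cvg_flat (u := fun n => - n%:R * x + n%:R * b)).
have -> : (fun n => - n%:R * x + n%:R * b) = (fun n => n%:R * (b - x)).
  by apply/funext => n; rewrite mulrBr mulNr addrC.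
by apply: cvg_natMy; rewrite subr_gt0.
Qed.

Let I01_indic_eq0 u a b : intg u ->
  (forall phi, test_function phi -> I01 (fun x => u x * phi x) = 0) ->
  0 < a -> b < 1 -> I01 (fun x => u x * \1_(`]a, b[%classic : set R) x) = 0.
Proof.
move=> ui u0 a0 b1.
have cb n := smooth_continuous (@smooth_bump R a b n).
have : I01 (fun x => u x * bump a b n%:R x) @[n --> \oo] -->
       I01 (fun x => u x * \1_(`]a, b[%classic : set R) x).
  apply: (@I01_dominated _ _ _ (fun x => `|u x|)).
  - move=> n; apply: measurable_funM; first exact: intg_measurable.
    exact: continuous_measurable_fun.
  - by apply: measurable_funM; [exact: intg_measurable|exact: measurable_indic].
  - exact: intg_norm.
  - move=> x x01; apply: cvgMr; rewrite indicE.
    have [xab|xab] := boolP (x \in `]a, b[).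
      by rewrite mem_set//; apply: cvg_bump; move: xab; rewrite in_itv.
    rewrite memNset; last by move=> /= xab'; rewrite xab' in xab.
    by under eq_fun do rewrite bump_out//; exact: cvg_cst.
  - move=> n x _; rewrite normrM -[leRHS]mulr1 ler_wpM2l//.
    by rewrite ger0_norm ?bump_ge0 ?bump_le1.
under eq_cvg do rewrite (u0 _ (test_bump a0 b1 (ler0n _ _))).
by move=> /(cvg_lim (@Rhausdorff R)) <-; exact: lim_cst.
Qed.

(** Bumps converge to the indicator of any interval inside the unit interval, so
    the primitive of [u] is constant there; by Lebesgue's differentiation
    theorem its derivative is [u] almost everywhere. *)
Lemma fundamental_lemma u : intg u ->
  (forall phi, test_function phi -> I01 (fun x => u x * phi x) = 0) ->
  u = cst 0 %[ae leb01].
Proof.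
move=> ui u0; have [mu_ uD] := (intgP u).1 ui.
have mD : measurable (D01 : set (measurableTypeR R)) by exact: measurable_itv.
pose v := u \_ D01.
have vi : mu.-integrable setT (EFin \o v).
  rewrite /v -restrict_EFin. exact: (@integrable_mkcond _ (measurableTypeR R) R mu D01 (EFin \o u) mD).1 uD.
have viD (i : interval R) : mu.-integrable [set` i] (EFin \o v).
  by apply: (integrableS _ _ _ vi) => //; exact: measurable_itv.
have := @FTC1 R v (BLeft 0) (fun y => viD _) (integrable_locally_restrict mD uD).
pose F x := (\int[mu]_(t in `[0%R, x]) v t)%R.
rewrite /= => vF; apply: ae_lebesgue_leb01; apply: filterS vF => x.
rewrite /= in_itv/= => H /andP[x0 x1] _.
have Fcst y z : 0 < y -> y <= z -> z < 1 -> F z = F y.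
  move=> y0 yz z1; apply/eqP; rewrite -subr_eq0 /F.
  rewrite Rintegral_itvB ?bnd_simp//; last exact: ltW.

  rewrite -Rintegral_itv_bndo_bndc//.
  rewrite -(I01_indic_eq0 ui u0 y0 z1) I01E; last first.
    by apply: measurable_funM => //; exact: measurable_indic.
  rewrite Rintegral_mkcond [in X in _ == X]Rintegral_mkcond; apply/eqP.
  apply: eq_Rintegral => t _; rewrite !patchE indicE.
  have [tyz|tyz] := boolP (t \in (`]y, z[%classic : set R)); last first.
    by rewrite mulr0; case: ifP.
  rewrite mulr1 /v patchE.
  rewrite mem_set//; move: tyz; rewrite inE/= !in_itv/= => /andP[t1 t2].
  by rewrite (lt_trans y0 t1) (lt_trans t2 z1).
have [_] := H x0; rewrite /v patchE mem_set/= ?in_itv/= ?x0// => <-.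
rewrite derive1E; apply: derive_val.
have dc := is_derive_cst (F x) x (1 : R).
apply: (near_eq_is_derive _ dc); near=> y; rewrite /cst.
have y0 : 0 < y by near: y; exact: lt_nbhsr.
have y1 : y < 1 by near: y; exact: lt_nbhsl.
have [xy|/ltW yx] := leP x y; first exact/esym/Fcst.
exact: Fcst.
Unshelve. all: by end_near. Qed.

End FundamentalLemma.

(** * Linear functionals vanishing on a common kernel *)

Section LinearFunctionals.
Context {R : realType}.
Implicit Types (f g : R -> R) (X : set (R -> R)) (L : (R -> R) -> R).

Definition lin_closed X := forall a b f g, X f -> X g ->
  X (fun x => a * f x + b * g x).

Definition lin_on X L := forall a b f g, X f -> X g ->
  L (fun x => a * f x + b * g x) = a * L f + b * L g.

(** If [L1] vanishes on [X] then so does [L]; otherwise subtracting a multiple of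
    one [h] with [L1 h != 0] moves any [f] into the kernel of [L1]. *)
Lemma functional_kernel X L L1 : lin_closed X -> lin_on X L -> lin_on X L1 ->
  (forall f, X f -> L1 f = 0 -> L f = 0) ->
  exists b, forall f, X f -> L f = b * L1 f.
Proof.
move=> cX lL lL1 ker.
have [[h Xh h0]|no] := pselect (exists2 h, X h & L1 h != 0); last first.
  exists 0 => f Xf; rewrite mul0r; apply: ker => //.
  by apply/eqP/negPn/negP => f0; apply: no; exists f.
exists (L h / L1 h) => f Xf.
have := ker _ (cX 1 (- (L1 f / L1 h)) f h Xf Xh).
rewrite lL// lL1// !mul1r !mulNr divfK// subrr => /(_ erefl) /eqP.
by rewrite subr_eq0 => /eqP ->; field.
Qed.

(** Apply the previous lemma on the kernel of [L0], then on the whole of [X]. *)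
Lemma functional_kernel2 X L L0 L1 : lin_closed X ->
  lin_on X L -> lin_on X L0 -> lin_on X L1 ->
  (forall f, X f -> L0 f = 0 -> L1 f = 0 -> L f = 0) ->
  exists a b, forall f, X f -> L f = a * L0 f + b * L1 f.
Proof.
move=> cX lL lL0 lL1 ker.
pose X0 := [set f | X f /\ L0 f = 0].
have [|||f [Xf]|b Lb] := @functional_kernel X0 L L1.
- move=> a b f g [Xf f0] [Xg g0]; split; first exact: cX.
  by rewrite lL0// f0 g0 !mulr0 addr0.
- by move=> a b f g [Xf _] [Xg _]; exact: lL.
- by move=> a b f g [Xf _] [Xg _]; exact: lL1.
- exact: ker.
have [|f Xf f0|a La] := @functional_kernel X (fun f => L f - b * L1 f) L0 cX _ lL0.
- by move=> a c f g Xf Xg; rewrite lL// lL1//; ring.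
- by rewrite Lb ?subrr.
by exists a, b => f Xf; rewrite -La// subrK.
Qed.

End LinearFunctionals.

(** * Green's formula against a weak second derivative *)

Section Green.
Context {R : realType}.
Implicit Types (f g h w phi psi u F G : R -> R) (a b c x y z : R).

Lemma norm_le_of_derive F f G g a b : (forall x, is_derive x 1 F (f x)) ->
  (forall x, is_derive x 1 G (g x)) -> a <= b ->
  (forall x, a < x < b -> `|f x| <= g x) -> `|F b - F a| <= G b - G a.
Proof.
move=> Ff Gg ab fg.
have h1 : G a - F a <= G b - F b.
  apply: (@le_of_derive _ (G - F) (fun x => g x - f x)) => // x xab.
  by rewrite subr_ge0 (le_trans (ler_norm _))// fg.
have h2 : G a + F a <= G b + F b.
  apply: (@le_of_derive _ (G + F) (fun x => g x + f x)) => // x xab.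
  rewrite -(opprK (f x)) subr_ge0 (le_trans (ler_norm _))// normrN.
  exact: fg.
rewrite ler_norml; apply/andP; split; lra.
Qed.

Lemma eq_of_derive0 f x y : smooth f -> x <= y ->
  (forall z, x < z < y -> derive1 f z = 0) -> f x = f y.
Proof.
move=> sf xy f0.
have := @norm_le_of_derive f (derive1 f) (cst 0) (cst 0) x y
  (fun x => smooth_is_derive x sf) (fun x => is_derive_cst _ _ _) xy.
rewrite subrr => H; apply/esym/eqP; rewrite -subr_eq0 -normr_le0.
by apply: H => z /f0 ->; rewrite normr0.
Qed.

Lemma eq0_left_of f x c : smooth f -> f c = 0 -> derive1 f c = 0 -> x <= c ->
  (forall z, x < z < c -> derive1n 2 f z = 0) -> f x = 0.
Proof.
move=> sf f0 f'0 xc f''0; rewrite -f0; apply: eq_of_derive0 => // y /andP[xy yc].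
rewrite -f'0; apply: eq_of_derive0; [exact: smooth_derive1|exact: ltW|].
by move=> z /andP[yz zc]; apply: f''0; rewrite zc (lt_trans xy).
Qed.

Lemma eq0_right_of f x c : smooth f -> f c = 0 -> derive1 f c = 0 -> c <= x ->
  (forall z, c < z < x -> derive1n 2 f z = 0) -> f x = 0.
Proof.
move=> sf f0 f'0 xc f''0; rewrite -f0; apply/esym/eq_of_derive0 => // y /andP[xy yc].
rewrite -f'0; apply/esym/eq_of_derive0; [exact: smooth_derive1|exact: ltW|].
by move=> z /andP[yz zc]; apply: f''0; rewrite yz (lt_trans zc).
Qed.

Lemma ex_double_primitive h : smooth h -> exists f,
  [/\ smooth f, derive1n 2 f = h, f 1 = 0 & derive1 f 1 = 0].
Proof.
move=> sh; have [P P1 dP] := ex_primitive (smooth_continuous sh).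
have sP := smooth_primitive dP sh.
have [f f1 df] := ex_primitive (smooth_continuous sP).
exists f; split => //.
- exact: smooth_primitive df sP.
- by rewrite -derive1_derive1 (derive1_eq df) (derive1_eq dP).
- by rewrite (derive1_eq df).
Qed.

(** The bounds come from integrating the second derivative twice from 1, on an
    interval of length at most 1. *)
Lemma double_primitive_bound f : smooth f -> f 1 = 0 -> derive1 f 1 = 0 ->
  forall x, 0 <= x <= 1 ->
  `|f x| <= I01 (fun y => `|derive1n 2 f y|) /\
  `|derive1 f x| <= I01 (fun y => `|derive1n 2 f y|).
Proof.
move=> sf f1 f'1.
have s1 := smooth_derive1 sf; have s2 := smooth_derive1 s1.
have cn : continuous (fun y => `|derive1n 2 f y|).
  move=> x; apply: continuous_comp; first exact: smooth_continuous s2 x.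
  exact: norm_continuous.
have [N N1 dN] := ex_primitive cn.
have -> := FTC01 dN cn.
have N0 x : 0 <= x <= 1 -> N 1 - N x <= N 1 - N 0.
  move=> /andP[x0 x1]; rewrite lerD2l lerN2.
  by apply: (le_of_derive dN) => // y _; exact: normr_ge0.
have bd x : 0 <= x <= 1 -> `|derive1 f x| <= N 1 - N 0.
  move=> x01; apply: le_trans (N0 x x01).
  have -> : derive1 f x = - (derive1 f 1 - derive1 f x) by rewrite f'1 sub0r opprK.
  rewrite normrN; case/andP: x01 => x0 x1.
  by apply: (norm_le_of_derive (fun y => smooth_is_derive y s1) dN).
move=> x /andP[x0 x1]; split; last by apply: bd; rewrite x0.
have -> : f x = - (f 1 - f x) by rewrite f1 sub0r opprK.
rewrite normrN.
have NN : 0 <= N 1 - N 0 by have := N0 1; rewrite ler01 lexx subrr => /(_ isT).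
have dG y : is_derive y 1 (fun y => (N 1 - N 0) * y) ((N 1 - N 0) * 1).
  exact: is_deriveZ.
apply: (@le_trans _ _ ((N 1 - N 0) * 1 - (N 1 - N 0) * x)); last first.
  by rewrite mulr1 gerBl mulr_ge0.
apply: (norm_le_of_derive (fun y => smooth_is_derive y sf) dG) => // y /andP[xy y1].
by rewrite mulr1; apply: bd; rewrite (ltW y1) ltW// (le_lt_trans x0).
Qed.

(** Test functions converging to 1 on the open unit interval, although bumps with a
    fixed support inside it cannot: both the support and the steepness grow. *)
Definition cutoff n : R -> R := bump (n.+2%:R^-1) (1 - n.+2%:R^-1) n%:R.

Lemma test_cutoff n : test_function (cutoff n).
Proof. by apply: test_bump => //; rewrite ?invr_gt0// gtrBl invr_gt0. Qed.

Lemma cvg_cutoff x : 0 < x < 1 -> cutoff n x @[n --> \oo] --> (1 : R).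
Proof.
move=> /andP[x0 x1]; rewrite -[X in _ --> X](mulr1 1).
have key y : 0 < y -> n%:R * y - n%:R * n.+2%:R^-1 @[n --> \oo] --> +oo.
  move=> y0; apply/cvgryPge => A; near=> n.
  have h : n%:R * n.+2%:R^-1 <= 1 :> R.
    by rewrite ler_pdivrMr ?mul1r ?ler_nat ?ltr0n// -addn2 leq_addr.
  rewrite lerBrDr (@le_trans _ _ (A + 1))// ?lerD2l// -ler_pdivrMr//.
  by near: n; exact: nbhs_infty_ger.
apply: cvgM.
  exact: (cvg_flat (u := fun n => n%:R * x + - (n%:R * n.+2%:R^-1)) (key _ x0)).
apply: (cvg_flat (u := fun n => - n%:R * x + n%:R * (1 - n.+2%:R^-1))).
have -> : (fun n => - n%:R * x + n%:R * (1 - n.+2%:R^-1)) =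
    (fun n => n%:R * (1 - x) - n%:R * n.+2%:R^-1).
  by apply/funext => n; rewrite !mulrBr mulr1 mulNr addrCA addrA.
by apply: key; rewrite subr_gt0.
Unshelve. all: by end_near. Qed.

Lemma cvg_I01_cutoff f : intg f ->
  I01 (fun x => `|f x| * (1 - cutoff n x)) @[n --> \oo] --> (0 : R).
Proof.
move=> fi; rewrite -[X in _ --> X](@I01_cst R).
have mf := intg_measurable fi.
apply: (@I01_dominated _ _ _ (fun x => `|f x|)).
- move=> n; apply: measurable_funM; first exact: measurableT_comp.
  apply: measurable_funB => //; apply: continuous_measurable_fun.
  exact/smooth_continuous/test_smooth/test_cutoff.
- exact: measurable_cst.
- exact: intg_norm.
- move=> x x01; rewrite -(mulr0 `|f x|); apply: cvgMr.
  by rewrite -(subrr 1); apply: cvgB; [exact: cvg_cst|exact: cvg_cutoff].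
- move=> n x _; rewrite normrM normr_id -[leRHS]mulr1 ler_wpM2l//.
  by rewrite ger0_norm ?subr_ge0 ?bump_le1// gerBl bump_ge0.
Qed.

Section GreenFormula.
Variables (g w : R -> R).
Hypotheses (gL : carrier L2 g) (wL : carrier L2 w) (gw : weak_derivative 2 g w).

Let L psi := I01 (fun x => g x * derive1n 2 psi x) - I01 (fun x => w x * psi x).

Let X := [set psi : R -> R | [/\ smooth psi, psi 1 = 0, derive1 psi 1 = 0 &
  test_function (derive1n 2 psi)]].

Let Xlin : lin_closed X.
Proof.
move=> a b f h [sf f1 f'1 tf] [sh h1 h'1 th]; split.
- exact: smooth_lin.
- by rewrite f1 h1 !mulr0 addr0.
- by rewrite (derive1_lin _ _ sf sh) f'1 h'1 !mulr0 addr0.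
- by rewrite (derive1n_lin _ _ _ sf sh); exact: test_lin.
Qed.

Let Llin : lin_on smooth L.
Proof.
move=> a b f h sf sh; rewrite /L (derive1n_lin _ _ _ sf sh).
have fL := L2_smooth sf; have hL := L2_smooth sh.
have f2L := L2_smooth (smooth_derive1n 2 sf).
have h2L := L2_smooth (smooth_derive1n 2 sh).
rewrite (L2_I01_linr _ _ gL f2L h2L) (L2_I01_linr _ _ wL fL hL).
by rewrite !mulrBr opprD addrACA.
Qed.

Let X_test psi : X psi -> psi 0 = 0 -> derive1 psi 0 = 0 -> test_function psi.
Proof.
move=> [spsi p1 p'1 /test_functionP[_ [a [b [a0 b1 pab]]]]] p0 p'0.
apply/test_functionP; split => //.
exists (Num.min a 1), (Num.max b 0); split.
- by rewrite lt_min a0 ltr01.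
- by rewrite gt_max b1 ltr01.
- move=> x; rewrite in_itv/= negb_and -!ltNge lt_min gt_max.
  case/orP => /andP[xa x1].
  + have [x0|/ltW x0] := leP x 0.
      apply: (eq0_left_of spsi p0 p'0 x0) => z /andP[xz z0].
      by apply: pab; rewrite in_itv/= negb_and -!ltNge (lt_trans z0 a0).
    apply: (eq0_right_of spsi p0 p'0 x0) => z /andP[z0 zx].
    by apply: pab; rewrite in_itv/= negb_and -!ltNge (lt_trans zx xa).
  + have [x0|/ltW x0] := leP x 1.
      apply: (eq0_left_of spsi p1 p'1 x0) => z /andP[xz z0].
      by apply: pab; rewrite in_itv/= negb_and -!ltNge (lt_trans xa xz) orbT.
    apply: (eq0_right_of spsi p1 p'1 x0) => z /andP[z0 zx].
    by apply: pab; rewrite in_itv/= negb_and -!ltNge (lt_trans b1 z0) orbT.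
Qed.

Let L_test psi : test_function psi -> L psi = 0.
Proof.
by move=> tp; rewrite /L ((weak_derivativeP _ _ _).1 gw _ tp) expr2 mulrNN !mul1r subrr.
Qed.

(** This replaces the regularity theory of [H2].  The weak derivative is tested
    only on functions that vanish near both ends.  Among the [psi] that vanish
    to second order at 1 and have a compactly supported second derivative, those
    that satisfy [psi 0 = psi' 0 = 0] are test functions, on which the left-hand side
    vanishes; so on these [psi] it is a combination of [psi 0] and [psi' 0], by
    [functional_kernel2].  A general [psi] is reached by cutting off its second
    derivative and integrating back twice from 1, which changes [psi] and
    [psi'] uniformly little.  The numbers [a] and [b] stand for the boundary
    values [g' 0] and [- g 0]. *)
Lemma weak_green_left : exists a b, forall psi, smooth psi ->
  psi 1 = 0 -> derive1 psi 1 = 0 ->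
  I01 (fun x => g x * derive1n 2 psi x) - I01 (fun x => w x * psi x) =
  a * psi 0 + b * derive1 psi 0.
Proof.
have XS f : X f -> smooth f by case.
have [||||a [b Lab]] := @functional_kernel2 R X L (fun f => f 0)
    (fun f => derive1 f 0) Xlin.
- by move=> a b f h /XS sf /XS sh; exact: Llin.
- by [].
- by move=> a b f h /XS sf /XS sh; rewrite (derive1_lin _ _ sf sh).
- by move=> f Xf f0 f'0; apply/L_test/X_test.
exists a, b => psi spsi p1 p'1; rewrite -/(L psi).
apply/eqP; rewrite -subr_eq0 -normr_le0.
have s2 := smooth_derive1n 2 spsi.
(* e n bounds the error made when psi'' is replaced by psi'' * cutoff n *)
pose K := I01 (fun x => `|w x|) + `|a| + `|b|.
pose e n := I01 (fun x => `|g x * derive1n 2 psi x| * (1 - cutoff n x)) +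
  K * I01 (fun x => `|derive1n 2 psi x| * (1 - cutoff n x)).
have e0 : e n @[n --> \oo] --> (0 : R).
  rewrite -[X in _ --> X](addr0 0) -[X in _ --> _ + X](mulr0 K).
  apply: cvgD.
    by apply/cvg_I01_cutoff/L2_intg_mul => //; exact: L2_smooth.
  apply: cvgMr.
  exact: (cvg_I01_cutoff (intg_continuous (smooth_continuous s2))).
suff le_e n : `|L psi - (a * psi 0 + b * derive1 psi 0)| <= e n.
  rewrite -[X in _ <= X](cvg_lim (@Rhausdorff R) e0).
  have ce : cvg (e n @[n --> \oo]) by apply/cvg_ex; exists 0.
  by apply: (limr_ge ce); apply: nearW => n; exact: le_e.
have tc := test_cutoff n.
have sc := test_smooth tc.
have [u [su u2 u1 u'1]] := ex_double_primitive (smooth_mul s2 sc).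
have Xu : X u by split => //; rewrite u2; exact: test_mul.
pose d := (fun x => 1 * psi x + (-1) * u x).
have sd : smooth d by exact: smooth_lin.
have d2 x : derive1n 2 d x = derive1n 2 psi x * (1 - cutoff n x).
  rewrite (derive1n_lin _ _ _ spsi su) u2.
  by rewrite mul1r mulN1r mulrBr mulr1.
have d1 : d 1 = 0 by rewrite /d p1 u1 !mulr0 addr0.
have d'1 : derive1 d 1 = 0 by rewrite (derive1_lin _ _ spsi su) p'1 u'1 !mulr0 addr0.
have c1 x : `|1 - cutoff n x| = 1 - cutoff n x.
  by rewrite ger0_norm// subr_ge0 bump_le1.
have dn x : `|derive1n 2 d x| = `|derive1n 2 psi x| * (1 - cutoff n x).
  by rewrite d2 normrM c1.
set eps := I01 (fun x => `|derive1n 2 psi x| * (1 - cutoff n x)).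
have bd := double_primitive_bound sd d1 d'1.
have epsE : I01 (fun y => `|derive1n 2 d y|) = eps := congr1 I01 (funext dn).
rewrite epsE in bd.
have -> : L psi - (a * psi 0 + b * derive1 psi 0) =
    I01 (fun x => g x * derive1n 2 d x) - I01 (fun x => w x * d x)
    - a * d 0 - b * derive1 d 0.
  rewrite -/(L d) (Llin 1 (-1) spsi su) (Lab u Xu) /d (derive1_lin _ _ spsi su).
  move: (L psi) (psi 0) (u 0) (derive1 psi 0) (derive1 u 0) => q1 q2 q3 q4 q5; ring.
have h1 : `|I01 (fun x => g x * derive1n 2 d x)| <=
    I01 (fun x => `|g x * derive1n 2 psi x| * (1 - cutoff n x)).
  apply: (le_trans (norm_I01 (L2_intg_mul gL (L2_smooth (smooth_derive1n 2 sd))))).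
  rewrite le_eqVlt; apply/orP; left; apply/eqP; congr I01; apply/funext => x.
  by rewrite d2 mulrA normrM c1.
have h2 : `|I01 (fun x => w x * d x)| <= I01 (fun x => `|w x|) * eps.
  apply: (le_trans (norm_I01 (L2_intg_mul wL (L2_smooth sd)))).
  have wn := intg_norm (L2_intg wL).
  have -> : I01 (fun x => `|w x|) * eps = I01 (fun x => eps * `|w x| + 0 * `|w x|).
    by rewrite I01_lin// mul0r addr0 mulrC.
  apply: le_I01; [by apply/intg_norm/L2_intg_mul => //; exact: L2_smooth|exact: intg_lin|].
  move=> x /andP[x0 x1]; rewrite mul0r addr0 normrM mulrC ler_wpM2r//.
  by apply: (bd x _).1; rewrite !ltW.
have h01 : 0 <= (0 : R) <= 1 by rewrite lexx ler01.
have h3 : `|a * d 0| <= `|a| * eps by rewrite normrM ler_wpM2l// (bd 0 h01).1.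
have h4 : `|b * derive1 d 0| <= `|b| * eps.
  by rewrite normrM ler_wpM2l// (bd 0 h01).2.
apply: (le_trans (ler_normB _ _)); apply: (le_trans (lerD (ler_normB _ _) h4)).
apply: (@le_trans _ _ (`|I01 (fun x => g x * derive1n 2 d x)| +
  `|I01 (fun x => w x * d x)| + `|a| * eps + `|b| * eps)).
  by rewrite lerD2r lerD// ler_normB.
rewrite /e -/eps /K !mulrDl !addrA.
by rewrite lerD2r lerD2r lerD.
Qed.

Lemma weak_green psi : smooth psi -> psi 1 = 0 -> derive1 psi 1 = 0 ->
  psi 0 = 0 -> derive1 psi 0 = 0 ->
  I01 (fun x => g x * derive1n 2 psi x) = I01 (fun x => w x * psi x).
Proof.
move=> sp p1 p'1 p0 p'0; have [a [b H]] := weak_green_left.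
have := H psi sp p1 p'1; rewrite p0 p'0 !mulr0 addr0 => /eqP.
by rewrite subr_eq0 => /eqP.
Qed.

End GreenFormula.
End Green.

(** * The weak form of the free-beam eigenvalue problem *)

Section WeakEigenproblem.
Context {R : realType}.
Implicit Types (f g h w phi psi u v F G : R -> R) (a b c x y z : R).

Lemma taylor_step F M m : smooth F -> F 1 = 0 ->
  (forall x, 0 <= x <= 1 -> `|derive1 F x| <= M * ((1 - x) ^+ m / m`!%:R)) ->
  forall x, 0 <= x <= 1 -> `|F x| <= M * ((1 - x) ^+ m.+1 / m.+1`!%:R).
Proof.
move=> sF F1 Fb x /andP[x0 x1].
pose G y := - M * ((1 - y) ^+ m.+1 / m.+1`!%:R).
have dG y : is_derive y 1 G (M * ((1 - y) ^+ m / m`!%:R)).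
  have d1 : is_derive y 1 (fun y : R => 1 - y) (0 - 1).
    exact: (is_deriveB (is_derive_cst _ _ _) (is_derive_id _ _)).
  have d2 := is_deriveZ (- M / m.+1`!%:R) (is_deriveX m.+1 d1).
  have -> : G = (- M / m.+1`!%:R) *: ((fun y : R => 1 - y) ^+ m.+1).
    apply/funext => z; rewrite /G !fctE /GRing.scale/=; ring.
  apply: (is_derive_congr d2); rewrite /GRing.scale/= sub0r factS natrM.
  rewrite -mulr_natl; field.
  by rewrite pnatr_eq0 -lt0n fact_gt0/= nat1r pnatr_eq0.
have -> : F x = - (F 1 - F x) by rewrite F1 sub0r opprK.
rewrite normrN.
have -> : M * ((1 - x) ^+ m.+1 / m.+1`!%:R) = G 1 - G x.
  rewrite /G subrr expr0n/= mul0r mulr0 sub0r mulNr opprK; ring.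
apply: (norm_le_of_derive (fun y => smooth_is_derive y sF) dG) => // y /andP[xy y1].
by apply: Fb; rewrite (ltW y1) ltW// (le_lt_trans x0).
Qed.

(** A fourfold integration from 1 raises the order of vanishing at 1 by four and
    gains the corresponding factorial. *)
Lemma volterra_step F M m : smooth F -> F 1 = 0 -> derive1 F 1 = 0 ->
  derive1n 2 F 1 = 0 -> derive1n 3 F 1 = 0 ->
  (forall x, 0 <= x <= 1 -> `|derive1n 4 F x| <= M * ((1 - x) ^+ m / m`!%:R)) ->
  forall x, 0 <= x <= 1 -> `|F x| <= M * ((1 - x) ^+ m.+4 / m.+4`!%:R).
Proof.
move=> sF F1 F'1 F21 F31 F4.
have s1 := smooth_derive1 sF; have s2 := smooth_derive1n 2 sF.
have s3 := smooth_derive1n 3 sF.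
apply: (taylor_step sF F1); apply: (taylor_step s1 F'1).
apply: (taylor_step s2 F21); apply: (taylor_step s3 F31).
exact: F4.
Qed.

Lemma quadruple_primitive h : smooth h -> exists F, [/\ smooth F,
  derive1n 4 F = h, F 1 = 0, derive1 F 1 = 0 &
  derive1n 2 F 1 = 0 /\ derive1n 3 F 1 = 0].
Proof.
move=> sh; have [G [sG G2 G1 G'1]] := ex_double_primitive sh.
have [F [sF F2 F1 F'1]] := ex_double_primitive sG.
exists F; split; [exact: sF| |exact: F1|exact: F'1|split].
- by rewrite -(derive1n_add 2 2) F2.
- by rewrite F2.
- by rewrite -derive1_derive1n F2.
Qed.

(** Iterating the hypothesis along fourfold primitives of a test function [phi]
    gives [I01 (F phi) = mu ^ n * I01 (F h)] with [h] of size [1 / (4 n)!]; let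
    [n] tend to infinity and apply the fundamental lemma. *)
Lemma volterra_unique F mu_ : carrier L2 F ->
  (forall G, smooth G -> G 1 = 0 -> derive1 G 1 = 0 ->
     derive1n 2 G 1 = 0 -> derive1n 3 G 1 = 0 ->
     I01 (fun x => F x * derive1n 4 G x) = mu_ * I01 (fun x => F x * G x)) ->
  F = cst 0 %[ae leb01].
Proof.
move=> FL FG; apply: fundamental_lemma; first exact: L2_intg.
move=> phi tphi; have sphi := test_smooth tphi.
have [M M0 phiM] := continuous_bounded01 (smooth_continuous sphi).
have iter n : exists h, [/\ smooth h,
    I01 (fun x => F x * phi x) = mu_ ^+ n * I01 (fun x => F x * h x) &
    forall x, 0 <= x <= 1 -> `|h x| <= M * ((1 - x) ^+ (4 * n) / (4 * n)`!%:R)].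
  elim: n => [|n [h [sh hE hM]]].
    exists phi; split => //; first by rewrite expr0 mul1r.
    by move=> x x01; rewrite muln0 expr0 divr1 mulr1; exact: phiM.
  have [G [sG G4 G1 G'1 [G21 G31]]] := quadruple_primitive sh.
  exists G; split; first exact: sG.
    by rewrite hE -G4 (FG _ sG G1 G'1 G21 G31) exprSr mulrA.
  move=> x x01; rewrite mulnS add4n.
  apply: (volterra_step sG G1 G'1 G21 G31) x01 => y y01.
  by rewrite G4; exact: hM.
set c := I01 _ in iter *.
have Fn := intg_norm (L2_intg FL).
pose B := M * I01 (fun x => `|F x|).
have bd n : `|c| <= `|mu_| ^+ n / n`!%:R * B.
  have [h [sh -> hM]] := iter n.
  rewrite normrM normrX -mulrA; apply: ler_wpM2l; first exact: exprn_ge0.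
  have hi : intg (fun x => F x * h x).
    exact: (intg_mul_continuous (L2_intg FL) (smooth_continuous sh)).
  apply: (le_trans (norm_I01 hi)).
  have -> : (n`!%:R)^-1 * B =
      I01 (fun x => M / n`!%:R * `|F x| + 0 * `|F x|).
    by rewrite I01_lin// mul0r addr0 /B; ring.
  apply: le_I01; [exact: intg_norm|exact: intg_lin|].
  move=> x /andP[x0 x1]; rewrite mul0r addr0 normrM mulrC ler_wpM2r//.
  apply: (le_trans (hM x _)); first by rewrite !ltW.
  rewrite ler_wpM2l//.
  apply: (@le_trans _ _ (1 / (4 * n)`!%:R)).
    rewrite ler_wpM2r ?invr_ge0//.
    by rewrite exprn_ile1// ?subr_ge0 ?gerBl ltW.
  rewrite div1r lef_pV2 ?posrE ?ltr0n ?fact_gt0// ler_nat.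
  by apply: leq_fact; rewrite leq_pmull.
have lim0 : `|mu_| ^+ n / n`!%:R * B @[n --> \oo] --> (0 : R).
  rewrite -[X in _ --> X](mul0r B); apply: cvgMl.
  have := cvg_series_cvg_0 (is_cvg_series_exp_coeff `|mu_|).
  by apply: cvg_trans; apply: near_eq_cvg; apply: nearW => n.
apply/eqP; rewrite -normr_le0 -[X in _ <= X](cvg_lim (@Rhausdorff R) lim0).
have cB : cvg (`|mu_| ^+ n / n`!%:R * B @[n --> \oo]) by apply/cvg_ex; exists 0.
by apply: (limr_ge cB); apply: nearW => n; exact: bd.
Qed.

Lemma weak_derivative_ae_unique n f g u v :
  carrier L2 f -> carrier L2 g -> carrier L2 u -> carrier L2 v ->
  f = g %[ae leb01] -> weak_derivative n f u -> weak_derivative n g v ->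
  u = v %[ae leb01].
Proof.
move=> fL gL uL vL fg fu gv.
have uv : carrier L2 (fun x => 1 * u x + (-1) * v x) by exact: L2_lin.
have : (fun x => 1 * u x + (-1) * v x) = cst 0 %[ae leb01].
  apply: fundamental_lemma; first exact: L2_intg.
  move=> phi tphi; have cphi := smooth_continuous (test_smooth tphi).
  have pL := L2_continuous cphi.
  have dpL := L2_continuous (smooth_continuous (test_smooth (test_derive1n n tphi))).
  rewrite (L2_I01_linl 1 (-1) pL uL vL).
  have fE := (weak_derivativeP _ _ _).1 fu phi tphi.
  have gE := (weak_derivativeP _ _ _).1 gv phi tphi.
  have fgE := L2_I01_aer dpL fL gL fg.
  have : (-1) ^+ n * I01 (fun x => u x * phi x) =
         (-1) ^+ n * I01 (fun x => v x * phi x).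
    by rewrite -fE -gE I01_mulC fgE I01_mulC.
  move/(mulfI _) => ->; last by rewrite signr_eq0.
  by rewrite -mulrDl subrr mul0r.
by apply: filterS => x /(_ I) /= /eqP; rewrite mul1r mulN1r subr_eq0 => /eqP.
Qed.

(** The eigenvalue problem of a beam with free ends.  The boundary conditions are
    the natural ones: they are forced by testing against functions of [H2] with
    arbitrary boundary values. *)
Definition free_mode (m : R) u :=
  [/\ smooth u, derive1n 4 u = (fun x => m * u x),
      derive1n 2 u 0 = 0 /\ derive1n 3 u 0 = 0 &
      derive1n 2 u 1 = 0 /\ derive1n 3 u 1 = 0].

(** [u''] vanishes to second order at both ends, hence is admissible in Green's
    formula although it need not have compact support. *)
Lemma free_mode_weak m u g w : free_mode m u -> carrier L2 g -> carrier L2 w ->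
  weak_derivative 2 g w ->
  I01 (fun x => w x * derive1n 2 u x) = m * I01 (fun x => g x * u x).
Proof.
move=> [su u4 [u20 u30] [u21 u31]] gL wL gw.
rewrite -(weak_green gL wL gw (smooth_derive1n 2 su) u21 u31 u20 u30).
by rewrite derive1n_add u4 (L2_I01_mulr _ gL (L2_smooth su)).
Qed.

(** Both [m] and [n] times the integral of [u v] equal the integral of
    [u'' v'']. *)
Lemma free_mode_orth m n u v : free_mode m u -> free_mode n v -> m != n ->
  I01 (fun x => u x * v x) = 0.
Proof.
move=> mu_ mv mn; have [su _ _ _] := mu_; have [sv _ _ _] := mv.
have h1 := free_mode_weak mu_ (L2_smooth sv) (L2_smooth (smooth_derive1n 2 sv))
  (smooth_weak_derivative 2 sv).
have h2 := free_mode_weak mv (L2_smooth su) (L2_smooth (smooth_derive1n 2 su))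
  (smooth_weak_derivative 2 su).
move: h1; rewrite I01_mulC h2 (I01_mulC v) => /eqP.
rewrite eq_sym -subr_eq0 -mulrBl mulf_eq0.
by rewrite subr_eq0 (negbTE mn) => /eqP.
Qed.

(** The first integral of [u'''' = m u]; [p], [q] and [r] are the successive
    derivatives of [u]. *)
Lemma energy_constant m (u p q r : R -> R) :
  (forall x, is_derive x 1 u (p x)) -> (forall x, is_derive x 1 p (q x)) ->
  (forall x, is_derive x 1 q (r x)) -> (forall x, is_derive x 1 r (m * u x)) ->
  q 0 = 0 -> r 0 = 0 -> forall x,
  m * u x ^+ 2 + q x ^+ 2 - 2 * (p x * r x) = m * u 0 ^+ 2.
Proof.
move=> du dp dq dr q0 r0 x.
pose K := fun x => m * u x ^+ 2 + q x ^+ 2 - 2 * (p x * r x).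
have -> : m * u 0 ^+ 2 = K 0 by rewrite /K q0 r0 expr0n/= !mulr0 subr0 addr0.
apply: (@is_derive_0_is_cst _ K) => y.
have dK := is_deriveB (is_deriveD (is_deriveZ m (is_deriveX 2 (du y)))
  (is_deriveX 2 (dq y))) (is_deriveZ 2 (is_deriveM (dp y) (dr y))).
by apply: (is_derive_congr dK); rewrite /GRing.scale/=; ring.
Qed.

Lemma free_mode_energy m u : free_mode m u -> forall x,
  m * u x ^+ 2 + derive1n 2 u x ^+ 2 - 2 * (derive1 u x * derive1n 3 u x)
  = m * u 0 ^+ 2.
Proof.
move=> [su u4 [u20 u30] _]; apply: (energy_constant _ _ _ _ u20 u30) => x.
- exact: (smooth_is_derive x su).
- exact: (smooth_is_derive x (smooth_derive1 su)).
- exact: (smooth_is_derive x (smooth_derive1n 2 su)).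
- have := smooth_is_derive x (smooth_derive1n 3 su).
  by rewrite derive1_derive1n u4.
Qed.

Let energy_split m (p q r s : R -> R) : m != 0 ->
  intg (fun x => p x * p x) -> intg (fun x => q x * q x) ->
  intg (fun x => r x * s x) ->
  (forall x, m * p x ^+ 2 + q x ^+ 2 - 2 * (r x * s x) = m * p 0 ^+ 2) ->
  I01 (fun x => q x * q x) = m * I01 (fun x => p x * p x) ->
  I01 (fun x => r x * s x) = - I01 (fun x => q x * q x) ->
  I01 (fun x => p x * p x) = p 0 ^+ 2 / 4.
Proof.
move=> m0 pp qq rs pqrs EB EC.
have : I01 (fun x => 1 * (m * (p x * p x) + 1 * (q x * q x)) +
    -2 * (r x * s x)) = m * p 0 ^+ 2.
  by rewrite -[RHS](@I01_cst R); congr I01; apply/funext => x /=;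
    rewrite -(pqrs x); ring.
rewrite I01_lin//; last exact: intg_lin.
rewrite I01_lin// EC EB; move: (I01 _) => A h.
by apply: (mulfI m0); lra.
Qed.

(** Integrate the identity [energy_constant].  By parts, [q ^ 2] contributes as
    much as [m u ^ 2], and [- 2 p r] twice as much, so four times the squared norm
    of [u] is [u 0 ^ 2], after division by [m].  Evaluating that identity at 1
    gives the second claim. *)
Lemma free_mode_norm m u : m != 0 -> free_mode m u ->
  I01 (fun x => u x * u x) = u 0 ^+ 2 / 4 /\ u 1 ^+ 2 = u 0 ^+ 2.
Proof.
move=> m0 mu_; have [su _ [u20 u30] [u21 u31]] := mu_.
have en := free_mode_energy mu_.
split; last first.
  by have := en 1; rewrite u21 u31 expr0n/= !mulr0 subr0 addr0 => /(mulfI m0).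
have s1 := smooth_derive1 su; have s2 := smooth_derive1n 2 su.
have s3 := smooth_derive1n 3 su.
have uL := L2_smooth su; have u1L := L2_smooth s1.
have u2L := L2_smooth s2; have u3L := L2_smooth s3.
have h1 := free_mode_weak mu_ uL u2L (smooth_weak_derivative 2 su).
have h2 := smooth_ibp s1 s2.
rewrite u20 u21 !mulr0 subrr sub0r derive1_derive1n derive1_derive1 in h2.
exact: (energy_split m0 (L2_intg_mul uL uL) (L2_intg_mul u2L u2L)
  (L2_intg_mul u1L u3L) en h1 h2).
Qed.

Let ibp_d (f f' g g' : R -> R) : smooth f -> smooth g ->
  derive1 f = f' -> derive1 g = g' ->
  I01 (fun x => f x * g' x) =
  f 1 * g 1 - f 0 * g 0 - I01 (fun x => f' x * g x).
Proof. by move=> sf sg <- <-; exact: smooth_ibp. Qed.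

Lemma ibp4 (u u1 u2 u3 u4 v v1 v2 v3 v4 : R -> R) : smooth u -> smooth v ->
  derive1 u = u1 -> derive1 u1 = u2 -> derive1 u2 = u3 -> derive1 u3 = u4 ->
  derive1 v = v1 -> derive1 v1 = v2 -> derive1 v2 = v3 -> derive1 v3 = v4 ->
  I01 (fun x => u x * v4 x) =
  (u 1 * v3 1 - u 0 * v3 0) - (u1 1 * v2 1 - u1 0 * v2 0) +
  (u2 1 * v1 1 - u2 0 * v1 0) - (u3 1 * v 1 - u3 0 * v 0) +
  I01 (fun x => u4 x * v x).
Proof.
move=> su sv du du1 du2 du3 dv dv1 dv2 dv3.
have su1 : smooth u1 by rewrite -du; exact: smooth_derive1.
have su2 : smooth u2 by rewrite -du1; exact: smooth_derive1.
have su3 : smooth u3 by rewrite -du2; exact: smooth_derive1.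
have sv1 : smooth v1 by rewrite -dv; exact: smooth_derive1.
have sv2 : smooth v2 by rewrite -dv1; exact: smooth_derive1.
have sv3 : smooth v3 by rewrite -dv2; exact: smooth_derive1.
rewrite (ibp_d su sv3 du dv3) (ibp_d su1 sv2 du1 dv2).
rewrite (ibp_d su2 sv1 du2 dv1) (ibp_d su3 sv du3 dv).
by move: (I01 _) => J; ring.
Qed.

(** This lemma and the next isolate the linear arithmetic of
    [weak_eigenfunction], with the derivatives abstracted into variables. *)
Let volterra_arith (m a b p q x y z t w c1 c2 c3 c4 c5 c6 : R) :
  x - w = a * p + b * q -> w = m * y ->
  z = (c1 * 0 - - b * q) - (c2 * 0 - a * p) + (c3 * 0 - 0 * c4)
      - (c5 * 0 - 0 * c6) + m * t ->
  1 * x + -1 * z = m * (1 * y + -1 * t).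
Proof. by move=> h wE ->; rewrite wE in h; lra. Qed.

Let boundary_arith (p q c1 c2 J : R) :
  p - q - (0 * c1 - 0 * c2) + J = J -> p = q.
Proof. lra. Qed.

(** Green's formula for [f] involves two unknown numbers [a] and [b]; let [E] be
    the classical solution with [E 0 = - b] and [E' 0 = a].  Then [f] and [E]
    have the same boundary terms at 0, and [f - E] satisfies the hypothesis of
    [volterra_unique].  So [f] is smooth, and testing with [1] and with [x]
    yields the boundary conditions at 1.  The set [S] records an explicit form
    of the classical solutions. *)
Lemma weak_eigenfunction m (S : set (R -> R)) f w :
  (forall a b, exists2 E, S E & [/\ smooth E,
     derive1n 4 E = (fun x => m * E x),
     derive1n 2 E 0 = 0, derive1n 3 E 0 = 0 & E 0 = a /\ derive1 E 0 = b]) ->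
  carrier L2 f -> carrier L2 w -> weak_derivative 2 f w ->
  (forall g, smooth g ->
     I01 (fun x => w x * derive1n 2 g x) = m * I01 (fun x => f x * g x)) ->
  exists2 E, S E /\ free_mode m E & f = E %[ae leb01].
Proof.
move=> exE fL wL fw fg.
have [a [b H]] := weak_green_left fL wL fw.
have [E SE [sE E4 E2 E3 [E0 E'0]]] := exE (- b) a.
have EL := L2_smooth sE.
have green G : smooth G -> I01 (fun x => E x * derive1n 4 G x) =
    (E 1 * derive1n 3 G 1 - E 0 * derive1n 3 G 0) -
    (derive1 E 1 * derive1n 2 G 1 - derive1 E 0 * derive1n 2 G 0) +
    (derive1n 2 E 1 * derive1 G 1 - derive1n 2 E 0 * derive1 G 0) -
    (derive1n 3 E 1 * G 1 - derive1n 3 E 0 * G 0) +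
    m * I01 (fun x => E x * G x).
  move=> sG; rewrite -(L2_I01_mull _ EL (L2_smooth sG)).
  have dE4 : derive1 (derive1n 3 E) = (fun x => m * E x) by [].
  exact: (ibp4 sE sG erefl erefl erefl dE4 erefl erefl erefl erefl).
have fE : f = E %[ae leb01].
  pose F x := 1 * f x + (-1) * E x.
  have FL : carrier L2 F by exact: L2_lin.
  have : F = cst 0 %[ae leb01].
    apply: (volterra_unique (mu_ := m) FL) => G sG G1 G'1 G21 G31.
    have GL := L2_smooth sG; have G4L := L2_smooth (smooth_derive1n 4 sG).
    rewrite (L2_I01_linl 1 (-1) GL fL EL) (L2_I01_linl 1 (-1) G4L fL EL).
    have h1 : I01 (fun x => f x * derive1n 4 G x) -
        I01 (fun x => w x * derive1n 2 G x) =
        a * derive1n 2 G 0 + b * derive1n 3 G 0 :=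
      H _ (smooth_derive1n 2 sG) G21 G31.
    have h2 := green G sG; rewrite G1 G'1 G21 G31 E2 E3 E0 E'0 in h2.
    exact: (volterra_arith h1 (fg _ sG) h2).
  by apply: filterS => x /(_ I) /= /eqP; rewrite /F mul1r mulN1r subr_eq0 => /eqP.
have wE : w = derive1n 2 E %[ae leb01].
  apply: (weak_derivative_ae_unique fL EL wL _ fE fw).
    exact/L2_smooth/smooth_derive1n.
  exact: smooth_weak_derivative.
exists E; last exact: fE.
split; first exact: SE.
have bc g : smooth g -> derive1n 2 E 1 * derive1 g 1 = derive1n 3 E 1 * g 1.
  move=> sg; have gL := L2_smooth sg; have g2L := L2_smooth (smooth_derive1n 2 sg).
  have e2 := smooth_derive1n 2 sE; have := fg g sg.
  rewrite (L2_I01_ael g2L wL (L2_smooth e2) wE) (L2_I01_ael gL fL EL fE).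
  have h : I01 (fun x => derive1n 2 E x * derive1n 2 g x) =
      (derive1n 2 E 1 * derive1 g 1 - derive1n 3 E 1 * g 1) -
      (derive1n 2 E 0 * derive1 g 0 - derive1n 3 E 0 * g 0) +
      I01 (fun x => derive1n 4 E x * g x) := smooth_ibp2 e2 sg.
  rewrite h E2 E3 E4 (L2_I01_mull _ EL gL).
  exact: boundary_arith.
have c1 : derive1n 3 E 1 = 0.
  have := bc (cst 1) (@smooth_cst _ 1).
  by rewrite derive1_cst mulr0 mulr1 => <-.
split; [exact: sE|exact: E4|by split|split; last exact: c1].
have := bc id (@smooth_id _); rewrite c1 mul0r => <-.
by rewrite derive1E derive_id mulr1.
Qed.

End WeakEigenproblem.

(** * Solutions of the free-beam equation *)

Section Hyperbolic.
Context {R : realType}.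
Implicit Types (x y z a b c d t : R).

Lemma cosh0 : cosh 0 = 1 :> R.
Proof. by rewrite /cosh oppr0 expR0; lra. Qed.

Lemma sinh0 : sinh 0 = 0 :> R.
Proof. by rewrite /sinh oppr0 subrr mul0r. Qed.

Lemma coshD x y : cosh (x + y) = cosh x * cosh y + sinh x * sinh y.
Proof. by rewrite /cosh /sinh opprD !expRD; lra. Qed.

Lemma sinhD x y : sinh (x + y) = sinh x * cosh y + cosh x * sinh y.
Proof. by rewrite /cosh /sinh opprD !expRD; lra. Qed.

Lemma cosh2Bsinh2 x : cosh x ^+ 2 - sinh x ^+ 2 = 1.
Proof.
rewrite /cosh /sinh; have := expRxMexpNx_1 x.
move: (expR x) (expR (- x)) => p q pq.
have -> : ((p + q) / 2) ^+ 2 - ((p - q) / 2) ^+ 2 = p * q by field.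
exact: pq.
Qed.

Lemma sinhB x y : sinh (x - y) = sinh x * cosh y - cosh x * sinh y.
Proof. by rewrite /cosh /sinh opprB !expRD; lra. Qed.

Lemma is_derive_cosh x : is_derive x 1 (@cosh R) (sinh x).
Proof.
have dN : is_derive x 1 (fun y : R => expR (- y)) (expR (- x) * -1).
  exact: (@is_derive1_comp _ expR -%R _ _ _ (is_derive_expR _) (is_deriveNid _ _)).
have -> : @cosh R = 2^-1 *: (@expR R + (fun y : R => expR (- y))).
  by apply/funext => y; rewrite /cosh !fctE /GRing.scale/= mulrC.
apply: (is_derive_congr (is_deriveZ 2^-1 (is_deriveD (is_derive_expR x) dN))).
by rewrite /sinh /GRing.scale/= mulrN1 mulrC.
Qed.

Lemma is_derive_sinh x : is_derive x 1 (@sinh R) (cosh x).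
Proof.
have dN : is_derive x 1 (fun y : R => expR (- y)) (expR (- x) * -1).
  exact: (@is_derive1_comp _ expR -%R _ _ _ (is_derive_expR _) (is_deriveNid _ _)).
have -> : @sinh R = 2^-1 *: (@expR R - (fun y : R => expR (- y))).
  by apply/funext => y; rewrite /sinh !fctE /GRing.scale/= mulrC.
apply: (is_derive_congr (is_deriveZ 2^-1 (is_deriveB (is_derive_expR x) dN))).
by rewrite /cosh /GRing.scale/= mulrN1 opprK mulrC.
Qed.

Lemma cosh_gt0 x : 0 < cosh x.
Proof. by rewrite /cosh divr_gt0// addr_gt0 ?expR_gt0. Qed.

Lemma cosh_ge1 x : 1 <= cosh x.
Proof.
have := cosh2Bsinh2 x; have := cosh_gt0 x.
move: (cosh x) (sinh x) => C S C0 CS; rewrite leNgt; apply/negP => C1; nra.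
Qed.

Lemma sinh_gt0 x : 0 < x -> 0 < sinh x.
Proof.
by move=> x0; rewrite /sinh divr_gt0// subr_gt0 ltr_expR; apply: (lt_trans _ x0); rewrite oppr_lt0.
Qed.

Lemma sinh_ge0 x : 0 <= x -> 0 <= sinh x.
Proof. by rewrite le_eqVlt => /predU1P[<-|/sinh_gt0/ltW//]; rewrite sinh0. Qed.

Lemma sinh_lt x y : x < y -> sinh x < sinh y.
Proof.
move=> xy; rewrite /sinh ltr_pM2r ?invr_gt0//; apply: ltrB; rewrite ltr_expR//.
by rewrite ltrN2.
Qed.

Lemma cosh_gt1 x : 0 < x -> 1 < cosh x.
Proof.
move=> /sinh_gt0; have := cosh2Bsinh2 x; have := cosh_gt0 x.
move: (cosh x) (sinh x) => C S C0 CS S0; rewrite ltNge; apply/negP => C1; nra.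
Qed.

Lemma sin_lt_sinh x : 0 < x -> sin x < sinh x.
Proof.
move=> x0.
have dF z : is_derive z 1 (@sinh R - @sin R) (cosh z - cos z).
  exact: (is_deriveB (is_derive_sinh z) (is_derive_sin z)).
have [c] := MVT x0 (fun z _ => dF z)
  (continuous_subspaceT (is_derive_continuous dF)).
rewrite in_itv/= => /andP[c0 cx].
rewrite !fctE sinh0 sin0 !subr0 => E.
rewrite -subr_gt0 E mulr_gt0// subr_gt0.
by apply: (le_lt_trans (cos_le1 _)); exact: cosh_gt1.
Qed.

Definition hyptrig t a b c d x :=
  (a * cosh (t * x) + b * sinh (t * x)) + (c * cos (t * x) + d * sin (t * x)).

Lemma is_derive_hyptrig t a b c d x : is_derive x 1 (hyptrig t a b c d)
  (hyptrig t (t * b) (t * a) (t * d) (- (t * c)) x).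
Proof.
have dt : is_derive x 1 ( *%R t) t.
  by have := is_deriveZ t (is_derive_id x (1 : R)); rewrite /GRing.scale/= mulr1.
have d1 := is_derive1_comp (is_derive_cosh (t * x)) dt.
have d2 := is_derive1_comp (is_derive_sinh (t * x)) dt.
have d3 := is_derive1_comp (is_derive_cos (t * x)) dt.
have d4 := is_derive1_comp (is_derive_sin (t * x)) dt.
apply: (is_derive_congr (is_deriveD
  (is_deriveD (is_deriveZ a d1) (is_deriveZ b d2))
  (is_deriveD (is_deriveZ c d3) (is_deriveZ d d4)))).
by rewrite /hyptrig /GRing.scale/=; ring.
Qed.

Lemma derive1_hyptrig t a b c d : derive1 (hyptrig t a b c d) =
  hyptrig t (t * b) (t * a) (t * d) (- (t * c)).
Proof. by apply: derive1_eq => x; exact: is_derive_hyptrig. Qed.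

Lemma smooth_hyptrig t a b c d : smooth (hyptrig t a b c d).
Proof.
apply: (@generated_algebra_smooth _
  [set f | exists a b c d, f = hyptrig t a b c d]); last first.
  by apply: gen_atom; exists a, b, c, d.
move=> _ [a' [b' [c' [d' ->]]]].
exists (hyptrig t (t * b') (t * a') (t * d') (- (t * c'))); last first.
  by move=> x; exact: is_derive_hyptrig.
by apply: gen_atom; exists (t * b'), (t * a'), (t * d'), (- (t * c')).
Qed.

Lemma derive1n_hyptrig t a b c d :
  [/\ derive1n 2 (hyptrig t a b c d) = hyptrig t (t ^+ 2 * a) (t ^+ 2 * b)
        (- (t ^+ 2 * c)) (- (t ^+ 2 * d)),
      derive1n 3 (hyptrig t a b c d) = hyptrig t (t ^+ 3 * b) (t ^+ 3 * a)
        (- (t ^+ 3 * d)) (t ^+ 3 * c) &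
      derive1n 4 (hyptrig t a b c d) = fun x => t ^+ 4 * hyptrig t a b c d x].
Proof.
split; rewrite /derive1n/= !derive1_hyptrig.
- by congr hyptrig; ring.
- by congr hyptrig; ring.
- by apply/funext => x; rewrite /hyptrig; ring.
Qed.

Lemma hyptrig0 t a b c d : hyptrig t a b c d 0 = a + c.
Proof. by rewrite /hyptrig !mulr0 cosh0 sinh0 cos0 sin0; lra. Qed.

(** The ratio for which the second derivative of [hyptrig t 1 (- s) 1 (- s)]
    vanishes at 1. *)
Definition shape t : R := (cosh t - cos t) / (sinh t - sin t).

Lemma shapeE t : 0 < t -> shape t * (sinh t - sin t) = cosh t - cos t.
Proof. by move=> t0; rewrite divfK// subr_eq0 gt_eqF// sin_lt_sinh. Qed.

(** [(sinh - sin) (sinh + sin) - (cosh - cos) ^ 2 = 2 (cosh cos - 1)], so at a root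
    the condition on the third derivative follows from that on the second. *)
Lemma shape_root t : 0 < t -> cosh t * cos t = 1 ->
  shape t * (cosh t - cos t) = sinh t + sin t.
Proof.
move=> t0 ct; have := shapeE t0; have := sin_lt_sinh t0.
have := cosh2Bsinh2 t; have := cos2Dsin2 t.
move: (cosh t) (sinh t) (cos t) (sin t) (shape t) ct => C S c s k Cc e1 e2 sS e3.
have h : (S - s) != 0 by rewrite subr_eq0 gt_eqF.
apply: (mulfI h); rewrite mulrA [_ * k]mulrC e3; nra.
Qed.

Lemma free_mode_hyptrig t : 0 < t -> cosh t * cos t = 1 ->
  free_mode (t ^+ 4) (hyptrig t 1 (- shape t) 1 (- shape t)).
Proof.
move=> t0 ct; have [h2 h3 h4] := derive1n_hyptrig t 1 (- shape t) 1 (- shape t).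
split; [exact: smooth_hyptrig|exact: h4|..]; rewrite h2 h3 ?hyptrig0.
  by split; ring.
rewrite /hyptrig !mulr1; split.
  transitivity (t ^+ 2 * ((cosh t - cos t) - shape t * (sinh t - sin t))).
    by ring.
  by rewrite (shapeE t0) subrr mulr0.
transitivity (t ^+ 3 * ((sinh t + sin t) - shape t * (cosh t - cos t))).
  by ring.
by rewrite (shape_root t0 ct) subrr mulr0.
Qed.

(** The conditions at 1 form a linear system in [a] and [b] of determinant
    [2 - 2 cosh t cos t]. *)
Lemma free_mode_hyptrig_inv t a b : 0 < t ->
  free_mode (t ^+ 4) (hyptrig t a b a b) ->
  b = - shape t * a /\ (cosh t * cos t <> 1 -> a = 0).
Proof.
move=> t0 [_ _ _]; have [-> -> _] := derive1n_hyptrig t a b a b.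
rewrite /hyptrig !mulr1 => -[h2 h3].
have t2 : t ^+ 2 != 0 by rewrite expf_neq0// gt_eqF.
have t3 : t ^+ 3 != 0 by rewrite expf_neq0// gt_eqF.
have {}h2 : a * (cosh t - cos t) + b * (sinh t - sin t) = 0.
  by apply: (mulfI t2); rewrite mulr0 -[RHS]h2; ring.
have {}h3 : a * (sinh t + sin t) + b * (cosh t - cos t) = 0.
  by apply: (mulfI t3); rewrite mulr0 -[RHS]h3; ring.
have e := shapeE t0; have sS := sin_lt_sinh t0.
have Ss : sinh t - sin t != 0 by rewrite subr_eq0 gt_eqF.
split.
  apply: (mulIf Ss).
  transitivity (- a * (shape t * (sinh t - sin t))); last by ring.
  by rewrite e; lra.
move=> ct; have := cosh2Bsinh2 t; have := cos2Dsin2 t.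
have {}ct : 2 - 2 * (cosh t * cos t) != 0.
  by apply/eqP => h; apply: ct; lra.
move=> e1 e2; apply: (mulIf ct); rewrite mul0r.
transitivity ((a * (cosh t - cos t) + b * (sinh t - sin t)) * (cosh t - cos t)
   - (a * (sinh t + sin t) + b * (cosh t - cos t)) * (sinh t - sin t)
   + a * (2 - (cos t ^+ 2 + sin t ^+ 2) - (cosh t ^+ 2 - sinh t ^+ 2))).
  by ring.
by rewrite h2 h3 e1 e2; ring.
Qed.

End Hyperbolic.

(** * The equation cosh x cos x = 1 and the size of the modes *)

Section Roots.
Context {R : realType}.
Implicit Types (x y z t : R) (j k : nat).

Definition char_root x : Prop := cosh x * cos x = 1.

(** At a root [cos x = 1 / cosh x], so [sin x ^ 2 = tanh x ^ 2]; the sign of the sine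
    is that of the interval. *)
Lemma char_root_sin j x : 0 <= x -> pi *+ j <= x <= pi *+ j.+1 ->
  char_root x -> (-1) ^+ j * sin x * cosh x = sinh x.
Proof.
move=> x0 /andP[jx xj] cx.
have s0 : 0 <= (-1) ^+ j * sin x.
  have := alternatingn (@sinDpi R) j (x - pi *+ j); rewrite subrK => ->.
  rewrite mulrA -exprMn mulrNN mulr1 expr1n mul1r sin_ge0_pi//.
  by rewrite subr_ge0 jx lerBlDr -mulrS.
have C0 := cosh_gt0 x; have S0 := sinh_ge0 x0.
have e1 := cosh2Bsinh2 x; have e2 := cos2Dsin2 x.
have e3 : ((-1) ^+ j * sin x) ^+ 2 = sin x ^+ 2.
  by rewrite exprMn -exprM mulnC exprM sqrrN expr1n expr1n mul1r.
apply/eqP; rewrite -(@eqrXn2 _ 2)//; last by rewrite mulr_ge0// ltW.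
apply/eqP; rewrite exprMn e3 -[sin x ^+ 2](addrK (cos x ^+ 2)) [sin x ^+ 2 + _]addrC e2.
rewrite mulrBl mul1r -exprMn [cos x * _]mulrC cx expr1n -e1; ring.
Qed.

(** Let [x < y] be two roots in the interval.  If [j] is odd, then
    [sin (y - x) = (sinh x - sinh y) / (cosh x cosh y) < 0], which is impossible
    as [0 < y - x <= pi].  If [j] is even, the half-angle formulas turn the
    equation into [sinh u cos u = cosh u sin u] with [u = x / 2], and the
    difference of the two sides has derivative [- 2 sinh u sin u], which has no
    zero between [x / 2] and [y / 2].  The case [j = 0], where 0 is a root,
    excludes positive roots up to [pi]. *)
Lemma char_root_unique j x y : 0 <= x -> x < y ->
  pi *+ j <= x -> y <= pi *+ j.+1 -> char_root x -> char_root y -> False.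
Proof.
move=> x0 xy jx yj cx cy.
have y0 : 0 < y := le_lt_trans x0 xy.
have sx : (-1) ^+ j * sin x * cosh x = sinh x.
  by apply: char_root_sin => //; rewrite jx ltW// (lt_le_trans xy).
have sy : (-1) ^+ j * sin y * cosh y = sinh y.
  by apply: char_root_sin => //; [exact: ltW|rewrite yj ltW// (le_lt_trans jx)].
have Cx := cosh_gt0 x; have Cy := cosh_gt0 y.
case: (boolP (odd j)) => oj.
- rewrite -signr_odd oj expr1 in sx sy.
  have : 0 <= sin (y - x).
    apply: sin_ge0_pi; rewrite subr_ge0 ltW//= lerBlDr.
    by apply: (le_trans yj); rewrite mulrS lerD2l.
  rewrite leNgt => /negP; apply; rewrite -(pmulr_llt0 _ (mulr_gt0 Cx Cy)).
  have -> : sin (y - x) * (cosh x * cosh y) = sinh x - sinh y.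
    transitivity ((sin y * cosh y) * (cosh x * cos x)
                  - (cosh y * cos y) * (sin x * cosh x)).
      by rewrite sinB; ring.
    by rewrite cx cy -sx -sy; ring.
  by rewrite subr_lt0 sinh_lt.
- rewrite -signr_odd (negbTE oj) expr0 !mul1r in sx sy.
  pose F := fun u : R => sinh u * cos u - cosh u * sin u.
  have dF (u : R) : is_derive u 1 F (- 2 * (sinh u * sin u)).
    apply: (is_derive_congr (is_deriveB
      (is_deriveM (is_derive_sinh u) (is_derive_cos u))
      (is_deriveM (is_derive_cosh u) (is_derive_sin u)))).
    by rewrite /GRing.scale/=; ring.
  have F0 z : char_root z -> sin z * cosh z = sinh z -> F (z / 2) = 0.
    have zE : z / 2 + z / 2 = z by field.
    rewrite /char_root -{1 2}zE => cz; rewrite -{1 2 3}zE.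
    move: (z / 2) cz => u.
    have e1 := cosh2Bsinh2 u; have e2 := cos2Dsin2 u; have C0 := cosh_gt0 u.
    rewrite cosD sinD sinhD coshD /F.
    move: (cosh u) (sinh u) (cos u) (sin u) e1 e2 C0.
    move=> C S c s e1 e2 C0 h1 h2 {zE sx sy cx cy Cx Cy}.
    have h0 : (C * C + S * S) * (c ^+ 2 + s ^+ 2) = C * C + S * S.
      by rewrite e2 mulr1.
    have h3 : c ^+ 2 * (C * C + S * S) = C ^+ 2 by lra.
    have h4 : s * c * (C * C + S * S) = S * C by lra.
    have Cn : C ^+ 1 != 0 by rewrite expr1 gt_eqF.
    apply: (mulfI Cn); rewrite mulr0 expr1.
    have : s * (c ^+ 2 * (C * C + S * S)) = c * (s * c * (C * C + S * S)) by ring.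
    rewrite h3 h4 => h5.
    transitivity (c * (S * C) - s * C ^+ 2); first by ring.
    by rewrite h5 subrr.
  have xy2 : x / 2 < y / 2 by rewrite ltr_pM2r ?invr_gt0.
  have [c] := Rolle xy2 (fun u _ => @ex_derive _ _ _ _ _ _ _ (dF u))
    (continuous_subspaceT (is_derive_continuous dF))
    (etrans (F0 _ cx sx) (esym (F0 _ cy sy))).
  rewrite in_itv/= => /andP[xc cy2] /@derive_val; rewrite (derive_val (is_derive := dF c)).
  apply/eqP; rewrite mulf_neq0 ?oppr_eq0// mulf_neq0//.
    by rewrite gt_eqF// sinh_gt0// (le_lt_trans _ xc)// divr_ge0.
  pose i := j./2.
  have ji : j = (i * 2)%N by rewrite muln2 -[LHS]odd_double_half (negbTE oj).
  have := alternatingn (@sinDpi R) i (c - pi *+ i); rewrite subrK => ->.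
  rewrite mulf_neq0 ?signr_eq0// gt_eqF// sin_gt0_pi//.
  have pij : pi *+ j = (pi *+ i) * 2 :> R by rewrite ji mulrnA mulr_natr.
  have p0 := @pi_gt0 R.
  have h1 : (pi *+ i) * 2 <= x by rewrite -pij.
  have h2 : y <= pi + (pi *+ i) * 2 by rewrite -pij -mulrS.
  by move: (pi *+ i) h1 h2 => q h1 h2; apply/andP; split; lra.
Qed.

Lemma cos_pin j : cos (pi *+ j) = (-1) ^+ j :> R.
Proof.
have := alternatingn (@cosDpi R) j 0; rewrite add0r cos0 mulr1; exact.
Qed.

Lemma continuous_char : continuous (fun x : R => cosh x * cos x).
Proof.
move=> x; apply: cvgM; last exact: continuous_cos.
exact: (is_derive_continuous is_derive_cosh).
Qed.

(** At the ends [cosh x cos x] is [(-1) ^ j cosh (j pi)], of alternating sign and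
    modulus greater than 1, so the value 1 is taken strictly in between. *)
Lemma char_root_exists j : (0 < j)%N ->
  exists2 x : R, pi *+ j < x < pi *+ j.+1 & char_root x.
Proof.
move=> j0; have p0 := @pi_gt0 R.
have pj i : (0 < i)%N -> 1 < cosh (pi *+ i : R).
  by move=> i0; apply: cosh_gt1; rewrite pmulrn_lgt0.
have le_j : pi *+ j <= pi *+ j.+1 :> R by rewrite mulrS lerDr ltW.
have [|x] := @IVT R (fun x => cosh x * cos x) (pi *+ j) (pi *+ j.+1) 1 le_j
  (continuous_subspaceT continuous_char).
  rewrite !cos_pin exprS mulN1r mulrN.
  have h1 := pj _ j0; have h2 := pj j.+1 isT.
  rewrite -signr_odd; case: odd; rewrite ?expr0 ?expr1 ?mulrN !mulr1 ?opprK.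
    by rewrite ge_min le_max (ltW h2) orbT andbT -subr_ge0; lra.
  by rewrite ge_min le_max (ltW h1) andbT -subr_ge0; lra.
rewrite in_itv/= => /andP[x1 x2] cx; exists x => //.
have ne i : (0 < i)%N -> x != pi *+ i.
  move=> i0; apply/eqP => xE; move: cx (pj i i0); rewrite xE cos_pin => h h1.
  have : `|cosh (pi *+ i) * (-1) ^+ i| = (1 : R) by rewrite h normr1.
  by rewrite normrM normrX normrN1 expr1n mulr1 gtr0_norm ?cosh_gt0//; lra.
by rewrite !lt_neqAle x1 x2 [_ *+ j == _]eq_sym !ne.
Qed.

Lemma char_root_floor x : 0 < x -> char_root x ->
  exists2 j, (0 < j)%N & pi *+ j <= x <= pi *+ j.+1.
Proof.
move=> x0 cx; have p0 := @pi_gt0 R.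
pose j := Num.truncn (x / pi).
have xp0 : 0 <= x / pi by rewrite divr_ge0// ltW.
have /andP[j1 j2] := truncn_itv xp0; rewrite -/j in j1 j2.
have jx : pi *+ j <= x by rewrite -mulr_natl -ler_pdivlMr.
have xj : x <= pi *+ j.+1 by rewrite -mulr_natl -ler_pdivrMr// ltW.
exists j; last by rewrite jx xj.
rewrite lt0n; apply/eqP => j0; rewrite j0 in xj.
apply: (@char_root_unique 0 0 x) => //.
by rewrite /char_root cosh0 cos0 mulr1.
Qed.

(** For [k >= 2], the unique root between [(k - 1) pi] and [k pi]. *)
Definition freq k : R :=
  xget 0 [set x | pi *+ k.-1 < x < pi *+ k /\ char_root x].

Lemma freqP k : (2 <= k)%N -> pi *+ k.-1 < freq k < pi *+ k /\ char_root (freq k).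
Proof.
case: k => [|[|k]]// _; have [x x1 x2] := @char_root_exists k.+1 isT.
by apply: (@xgetPex _ 0 [set x | pi *+ k.+1 < x < pi *+ k.+2 /\ char_root x]); exists x.
Qed.

Lemma freq_gt0 k : (2 <= k)%N -> 0 < freq k.
Proof.
move=> k2; have [/andP[h _] _] := freqP k2; apply: le_lt_trans h.
by rewrite mulrn_wge0// ltW// pi_gt0.
Qed.

Lemma freq_lt j k : (2 <= j < k)%N -> freq j < freq k.
Proof.
move=> /andP[j2 jk]; have [/andP[_ h1] _] := freqP j2.
have [/andP[h2 _] _] := freqP (leq_trans j2 (ltnW jk)).
apply: (lt_trans h1); apply: le_lt_trans h2.
by rewrite ler_wpMn2l ?pi_ge0//; case: k jk.
Qed.

Lemma freq_range : [set freq k | k in [set k | (2 <= k)%N]] =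
  [set x : R | 0 < x /\ cosh x * cos x = 1].
Proof.
apply/seteqP; split=> [_ [k k2 <-]|x [x0 cx]].
  by split; [exact: freq_gt0|have [_] := freqP k2].
have [j j0 /andP[jx xj]] := char_root_floor x0 cx.
have j2 : (2 <= j.+1)%N by [].
have [/andP[f1 f2] cf] := freqP j2; rewrite /= in f1.
exists j.+1 => //.
have [fx|xf|//] := ltgtP (freq j.+1) x.
- by case: (char_root_unique (ltW (freq_gt0 j2)) fx (ltW f1) xj cf cx).
- by case: (char_root_unique (ltW x0) xf jx (ltW f2) cx cf).
Qed.

Lemma sinh4_ge : 21 <= sinh (4 : R).
Proof.
have e1 : (9 / 8 : R) <= expR (1 / 8) by apply: le_trans (expR_ge1Dx _); lra.
have e2 : (9 / 8 : R) ^+ 32 <= expR (1 / 8) ^+ 32.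
  by rewrite ler_pXn2r ?nnegrE ?expR_ge0//; lra.
have e3 : expR (1 / 8) ^+ 32 = expR 4 :> R.
  by rewrite -expRM_natl; congr expR; lra.
have e4 : (43 : R) <= (9 / 8) ^+ 32 by lra.
have e5 : expR (- 4 : R) <= 1 by rewrite expR_le1; lra.
rewrite /sinh; lra.
Qed.

(** [shape t ^ 2 = (sinh t + sin t) / (sinh t - sin t)] at a root.  This is at most
    1 for [k = 2], where the sine is not positive; for [k >= 3] the root exceeds
    [2 pi >= 4], and [sinh 4 >= 21] is enough. *)
Lemma shape_freq_sqr k : (2 <= k)%N -> shape (freq k) ^+ 2 <= 11 / 10 :> R.
Proof.
move=> k2; have [/andP[f1 f2] cf] := freqP k2; have f0 := freq_gt0 k2.
have e := shapeE f0; have r := shape_root f0 cf; have sS := sin_lt_sinh f0.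
have S0 := sinh_gt0 f0.
have {}e : shape (freq k) ^+ 2 * (sinh (freq k) - sin (freq k)) =
    sinh (freq k) + sin (freq k) by rewrite expr2 -mulrA e r.
have Ss : 0 < sinh (freq k) - sin (freq k) by rewrite subr_gt0.
rewrite -(ler_pM2r Ss) e.
have [k3|k3] := leqP 3 k.
  have f4 : 4 <= freq k.
    have p2 := @pi_ge2 R; have : pi *+ 2 <= pi *+ k.-1 :> R.
      by rewrite ler_wpMn2l ?pi_ge0//; case: k k3 {k2 f1 f2 cf f0 e r sS S0 Ss}.
    by rewrite mulr2n; lra.
  have S4 : 21 <= sinh (freq k).
    apply: (le_trans sinh4_ge); move: f4; rewrite le_eqVlt => /predU1P[<-//|f4].
    exact/ltW/sinh_lt.
  have := sin_le1 (freq k); lra.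
have kE : k = 2%N by apply/eqP; rewrite eqn_leq k2 -ltnS k3.
have s0 : sin (freq k) <= 0.
  rewrite kE in f1 f2 *; rewrite /= mulr1n in f1.
  have := @sinDpi R (freq 2 - pi); rewrite subrK => ->.
  rewrite oppr_le0 sin_ge0_pi// subr_ge0 ltW//= lerBlDr -mulr2n.
  exact: ltW.
by lra.
Qed.

Lemma sinh_superadd x y : 0 <= x -> 0 <= y -> sinh x + sinh y <= sinh (x + y).
Proof.
move=> x0 y0; rewrite sinhD; have := cosh_ge1 x; have := cosh_ge1 y.
have := sinh_ge0 x0; have := sinh_ge0 y0.
by move: (cosh x) (cosh y) (sinh x) (sinh y) => *; nra.
Qed.

(** Split the mode into a hyperbolic part [p] and a trigonometric part [q].  As
    [p 0 = 1] and [p 1 = 1] or [- 1], superadditivity of [sinh] gives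
    [`|p| <= 1]; and [q ^ 2 <= 1 + shape t ^ 2 <= 21/10].  Then
    [1 + sqrt (21/10) <= sqrt 6], with little to spare. *)
Lemma hyptrig_bound t x : 0 < t -> char_root t -> shape t ^+ 2 <= 11 / 10 ->
  0 <= x <= 1 ->
  `|hyptrig t 1 (- shape t) 1 (- shape t) x| <= Num.sqrt 6.
Proof.
move=> t0 ct c2 /andP[x0 x1].
pose p y := cosh (t * y) - shape t * sinh (t * y).
pose q y := cos (t * y) - shape t * sin (t * y).
have -> : hyptrig t 1 (- shape t) 1 (- shape t) x = p x + q x.
  by rewrite /hyptrig /p /q; ring.
have p1 : p 1 ^+ 2 = 1.
  have fm := free_mode_hyptrig t0 ct.
  have t4 : t ^+ 4 != 0 by rewrite expf_neq0// gt_eqF.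
  have [_] := free_mode_norm t4 fm; rewrite hyptrig0.
  have -> : hyptrig t 1 (- shape t) 1 (- shape t) 1 = 2 * p 1.
    have := shapeE t0; rewrite /hyptrig /p !mulr1 => e; lra.
  by move=> h; lra.
have pn : `|p 1| = 1.
  by apply/eqP; rewrite -(@eqrXn2 _ 2)// -normrX p1 normr1 expr1n.
have St := sinh_gt0 t0.
have pE : p x * sinh t = sinh (t - t * x) + p 1 * sinh (t * x).
  by rewrite sinhB /p !mulr1; ring.
have px : `|p x| <= 1.
  rewrite -(ler_pM2r St) mul1r -{1}(gtr0_norm St) -normrM pE.
  apply: (le_trans (ler_normD _ _)); rewrite (normrM (p 1)) pn mul1r.
  have tx : 0 <= t * x by rewrite mulr_ge0// ltW.
  have ttx : 0 <= t - t * x by rewrite subr_ge0 ger_pMr.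
  rewrite !ger0_norm ?sinh_ge0//.
  by apply: (le_trans (sinh_superadd ttx tx)); rewrite subrK.
have qx : `|q x| ^+ 2 <= 21 / 10.
  rewrite -normrX ger0_norm ?sqr_ge0// /q.
  have := cos2Dsin2 (t * x); have := sqr_ge0 (shape t * cos (t * x) + sin (t * x)).
  move: (cos (t * x)) (sin (t * x)) (shape t) c2 => c s k k2 h1 h2.
  have : (c - k * s) ^+ 2 + (k * c + s) ^+ 2 = (1 + k ^+ 2) * (c ^+ 2 + s ^+ 2).
    by ring.
  by rewrite h2; lra.
apply: (le_trans (ler_normD _ _)).
have q0 := normr_ge0 (q x); have p0 := normr_ge0 (p x).
(* 218 / 89 = 1 + 129 / 89 is a convergent of sqrt 6, from below *)
have q1 : `|q x| <= 129 / 89.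
  rewrite leNgt; apply/negP => h; have : (129 / 89) ^+ 2 < `|q x| ^+ 2.
    by rewrite ltr_pXn2r// nnegrE; lra.
  lra.
rewrite -[leLHS]ger0_norm ?addr_ge0// -sqrtr_sqr ler_sqrt//.
have h : `|p x| + `|q x| <= 218 / 89 by lra.
apply: (@le_trans _ _ ((218 / 89) ^+ 2)); last lra.
by rewrite ler_pXn2r// nnegrE; lra.
Qed.

End Roots.

(** * The Sobolev inner product *)

HB.lock Definition ipH2 {R : realType} (f g : R -> R) : R := inner H2 f g.

Section SobolevSpace.
Context {R : realType}.
Implicit Types (f g h u v : R -> R) (a b c x : R) (n : nat).

Lemma weak_derivative_lin n a b f g u v : carrier L2 f -> carrier L2 g ->
  carrier L2 u -> carrier L2 v ->
  weak_derivative n f u -> weak_derivative n g v ->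
  weak_derivative n (fun x => a * f x + b * g x) (fun x => a * u x + b * v x).
Proof.
move=> fL gL uL vL /weak_derivativeP fu /weak_derivativeP gv.
apply/weak_derivativeP => phi tphi.
have pL := L2_smooth (test_smooth tphi).
have dpL := L2_smooth (test_smooth (test_derive1n n tphi)).
rewrite (L2_I01_linl _ _ dpL fL gL) (L2_I01_linl _ _ pL uL vL).
by rewrite (fu _ tphi) (gv _ tphi); ring.
Qed.

Lemma H2_L2 f : carrier H2 f -> carrier L2 f.
Proof. by case. Qed.

Lemma weakDP f : carrier H2 f ->
  carrier L2 (weakD 2 f) /\ weak_derivative 2 f (weakD 2 f).
Proof.
move=> [_ fH]; have [w wL fw] := fH 2%N isT.
by apply: (@xgetPex _ (cst 0) [set g | carrier L2 g /\ weak_derivative 2 f g]);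
  exists w.
Qed.

Lemma weakD_L2 f : carrier H2 f -> carrier L2 (weakD 2 f).
Proof. by case/weakDP. Qed.

Lemma weakD_weak f : carrier H2 f -> weak_derivative 2 f (weakD 2 f).
Proof. by case/weakDP. Qed.

Lemma H2_lin a b f g : carrier H2 f -> carrier H2 g ->
  carrier H2 (fun x => a * f x + b * g x).
Proof.
move=> [fL fH] [gL gH]; split; first exact: L2_lin.
move=> k k2; have [u uL fu] := fH k k2; have [v vL gv] := gH k k2.
exists (fun x => a * u x + b * v x); first exact: L2_lin.
exact: weak_derivative_lin.
Qed.

Lemma H2_smooth f : smooth f -> carrier H2 f.
Proof.
move=> sf; split; first exact: L2_smooth.
move=> k _; exists (derive1n k f); first exact/L2_smooth/smooth_derive1n.
exact: smooth_weak_derivative.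
Qed.

Lemma weakD_smooth f : smooth f -> weakD 2 f = derive1n 2 f %[ae leb01].
Proof.
move=> sf; have fH := H2_smooth sf; have fL := L2_smooth sf.
apply: (weak_derivative_ae_unique fL fL (weakD_L2 fH)
  (L2_smooth (smooth_derive1n 2 sf)) _ (weakD_weak fH)
  (smooth_weak_derivative 2 sf)).
exact: ae_eq_on01.
Qed.

Lemma weakD_lin a b f g : carrier H2 f -> carrier H2 g ->
  weakD 2 (fun x => a * f x + b * g x) =
  (fun x => a * weakD 2 f x + b * weakD 2 g x) %[ae leb01].
Proof.
move=> fH gH; have hH := H2_lin a b fH gH.
have h2 := weak_derivative_lin a b (H2_L2 fH) (H2_L2 gH) (weakD_L2 fH)
  (weakD_L2 gH) (weakD_weak fH) (weakD_weak gH).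
apply: (weak_derivative_ae_unique (H2_L2 hH) (H2_L2 hH) (weakD_L2 hH)
  (L2_lin a b (weakD_L2 fH) (weakD_L2 gH)) _ (weakD_weak hH) h2).
exact: ae_eq_on01.
Qed.

Lemma weakD_ae f g : carrier H2 f -> carrier H2 g -> f = g %[ae leb01] ->
  weakD 2 f = weakD 2 g %[ae leb01].
Proof.
move=> fH gH fg; exact: (weak_derivative_ae_unique (H2_L2 fH) (H2_L2 gH)
  (weakD_L2 fH) (weakD_L2 gH) fg (weakD_weak fH) (weakD_weak gH)).
Qed.

Lemma ipH2_def f g : ipH2 f g = inner H2 f g.
Proof. by rewrite ipH2.unlock. Qed.

Lemma ipH2E f g : ipH2 f g =
  I01 (fun x => f x * g x) + I01 (fun x => weakD 2 f x * weakD 2 g x).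
Proof. by rewrite ipH2_def !I01_def. Qed.

Lemma ipH2C f g : ipH2 f g = ipH2 g f.
Proof. by rewrite !ipH2E I01_mulC (I01_mulC (weakD 2 f)). Qed.

Lemma ipH2_linr a b f g h : carrier H2 f -> carrier H2 g -> carrier H2 h ->
  ipH2 f (fun x => a * g x + b * h x) =
  a * ipH2 f g + b * ipH2 f h.
Proof.
move=> fH gH hH; rewrite !ipH2E.
rewrite (L2_I01_linr _ _ (H2_L2 fH) (H2_L2 gH) (H2_L2 hH)).
rewrite (L2_I01_aer (weakD_L2 fH) (weakD_L2 (H2_lin a b gH hH)) _
  (weakD_lin a b gH hH)); last by apply: L2_lin; exact: weakD_L2.
rewrite (L2_I01_linr _ _ (weakD_L2 fH) (weakD_L2 gH) (weakD_L2 hH)); ring.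
Qed.

Lemma ipH2_scaler a f g : carrier H2 f -> carrier H2 g ->
  ipH2 f (fun x => a * g x) = a * ipH2 f g.
Proof.
move=> fH gH; have := ipH2_linr a 0 fH gH gH; rewrite mul0r addr0 => <-.
by congr (ipH2 f _); apply/funext => x; rewrite mul0r addr0.
Qed.

Lemma H2_scale a f : carrier H2 f -> carrier H2 (fun x => a * f x).
Proof.
move=> fH; rewrite (_ : (fun x => a * f x) = fun x => a * f x + 0 * f x).
  exact: H2_lin.
by apply/funext => x; rewrite mul0r addr0.
Qed.

Lemma ipH2_aer f g h : carrier H2 f -> carrier H2 g -> carrier H2 h ->
  g = h %[ae leb01] -> ipH2 f g = ipH2 f h.
Proof.
move=> fH gH hH gh; rewrite !ipH2E.
rewrite (L2_I01_aer (H2_L2 fH) (H2_L2 gH) (H2_L2 hH) gh).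
by rewrite (L2_I01_aer (weakD_L2 fH) (weakD_L2 gH) (weakD_L2 hH) (weakD_ae gH hH gh)).
Qed.

Lemma I01_sqr_ge0 f : 0 <= I01 (fun x => f x * f x).
Proof.
by rewrite I01_def; apply: Rintegral_ge0 => x _; rewrite -expr2 sqr_ge0.
Qed.

Lemma ipH2_ge f : I01 (fun x => f x * f x) <= ipH2 f f.
Proof. by rewrite ipH2E lerDl I01_sqr_ge0. Qed.

(** The [H2] norm dominates the [L2] norm. *)
Lemma H2_eq_of_inner u v : carrier H2 u -> carrier H2 v ->
  (forall g, carrier H2 g -> ipH2 g u = ipH2 g v) -> u = v %[ae leb01].
Proof.
move=> uH vH uv.
have dH := H2_lin 1 (-1) uH vH.
have : (fun x => 1 * u x + -1 * v x) = cst 0 %[ae leb01].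
  apply: (I01_sqr_eq0 (H2_L2 dH)).
  apply/eqP; rewrite eq_le I01_sqr_ge0 andbT.
  apply: (le_trans (ipH2_ge _)).
  by rewrite (ipH2_linr _ _ dH uH vH) (uv _ dH) -mulrDl subrr mul0r.
by apply: filterS => x /(_ I) /= /eqP; rewrite mul1r mulN1r subr_eq0 => /eqP.
Qed.

End SobolevSpace.

(** * The operator W and its eigenspaces *)

Section EmbeddingOperator.
Context {R : realType}.
Variable W : (R -> R) -> (R -> R).
Hypothesis hW : adjoint H2 L2 (@embedding R) W.
Implicit Types (f g h u v : R -> R) (a b c x : R) (n : nat).

Lemma W_H2 f : carrier H2 f -> carrier H2 (W f).
Proof. by case: hW => _ h _ /H2_L2 /h. Qed.

Lemma W_inner f g : carrier H2 f -> carrier H2 g ->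
  I01 (fun x => f x * g x) = ipH2 f (W g).
Proof.
move=> fH gH; case: hW => _ _ h.
by have := h f g fH (H2_L2 gH); rewrite innerL2E ipH2_def.
Qed.

Lemma W_adjoint : adjoint H2 H2 W W.
Proof.
split; [exact: W_H2|exact: W_H2|] => f g fH gH.
rewrite -!ipH2_def ipH2C -(W_inner gH fH) -(W_inner fH gH).
exact: I01_mulC.
Qed.

(** Test the eigenvalue equation in the [H2] inner product, where [W] is
    characterised. *)
Lemma eigen_spaceP (l : R) f : carrier H2 f -> eigen_space H2 W l f <->
  forall g, carrier H2 g -> I01 (fun x => g x * f x) = l * ipH2 g f.
Proof.
move=> fH; have lfH := H2_scale l fH; split.
  move=> [_ Wf] g gH; rewrite (W_inner gH fH) -(ipH2_scaler l gH fH).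
  exact: (ipH2_aer gH (W_H2 fH) lfH Wf).
move=> H; split; first exact: fH.
apply: (H2_eq_of_inner (W_H2 fH) lfH) => g gH.
by rewrite -(W_inner gH fH) (H g gH) (ipH2_scaler l gH fH).
Qed.

(** Factor [W ^ 2 - l ^ 2 = (W + l) (W - l)]; as [W] is nonnegative, [W + l] is
    injective. *)
Lemma eigen_space_sqr (l : R) f : 0 < l ->
  eigen_space H2 (W \o W) (l ^+ 2) f <-> eigen_space H2 W l f.
Proof.
move=> l0; split=> -[fH].
  move=> WWf; have hH := W_H2 fH; have dH := H2_lin 1 (- l) hH fH.
  have Hd g : carrier H2 g ->
      I01 (fun x => g x * (1 * W f x + - l * f x)) =
      - l * ipH2 g (fun x => 1 * W f x + - l * f x).
    move=> gH; rewrite (L2_I01_linr _ _ (H2_L2 gH) (H2_L2 hH) (H2_L2 fH)).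
    rewrite (ipH2_linr _ _ gH hH fH) (W_inner gH hH) (W_inner gH fH).
    rewrite (ipH2_aer gH (W_H2 hH) (H2_scale (l ^+ 2) fH) WWf).
    rewrite (ipH2_scaler _ gH fH); move: (ipH2 g f) (ipH2 g (W f)) => p q.
    by ring.
  have : (fun x => 1 * W f x + - l * f x) = cst 0 %[ae leb01].
    apply: (I01_sqr_eq0 (H2_L2 dH)).
    apply/eqP; rewrite eq_le I01_sqr_ge0 andbT (Hd _ dH).
    rewrite mulNr oppr_le0 (mulr_ge0 (ltW l0))//.
    exact: (le_trans (I01_sqr_ge0 _) (ipH2_ge _)).
  move=> d0; split; first exact: fH.
  apply: filterS d0 => x /(_ I) /= /eqP.
  by rewrite mul1r mulNr subr_eq0 => /eqP.
move=> Wf; split; first exact: fH.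
have hH := W_H2 fH.
apply: (H2_eq_of_inner (W_H2 hH) (H2_scale (l ^+ 2) fH)) => g gH.
rewrite -(W_inner gH hH) (L2_I01_aer (H2_L2 gH) (H2_L2 hH) (H2_L2 (H2_scale l fH)) Wf).
rewrite (L2_I01_mulr _ (H2_L2 gH) (H2_L2 fH)) (W_inner gH fH).
rewrite (ipH2_aer gH hH (H2_scale l fH) Wf) !(ipH2_scaler _ gH fH).
by rewrite mulrA.
Qed.

Lemma free_mode_eigen m u : 0 <= m -> free_mode m u ->
  eigen_space H2 W (1 + m)^-1 u.
Proof.
move=> m0 mu_; have [su _ _ _] := mu_; have uH := H2_smooth su.
apply/(eigen_spaceP _ uH) => g gH; rewrite ipH2E.
rewrite (L2_I01_aer (weakD_L2 gH) (weakD_L2 uH)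
  (L2_smooth (smooth_derive1n 2 su)) (weakD_smooth su)).
rewrite (free_mode_weak mu_ (H2_L2 gH) (weakD_L2 gH) (weakD_weak gH)).
have m1 : 1 + m != 0 by rewrite gt_eqF// ltr_pwDl.
by move: (I01 _) => J; field.
Qed.

(** [W] has norm at most 1, the [H2] norm being at least the [L2] norm. *)
Lemma eigen_gt1 (l : R) f : 1 < l -> eigen_space H2 W l f ->
  f = cst 0 %[ae leb01].
Proof.
move=> l1 ef; have [fH _] := ef.
have := (eigen_spaceP l fH).1 ef f fH.
have := ipH2_ge f; have := I01_sqr_ge0 f; move: (ipH2 f f) => q.
move=> h1 h2 h3; apply: I01_sqr_eq0; first exact: H2_L2.
by move: (I01 _) h1 h2 h3 => p h1 h2 h3; nra.
Qed.

(** Against smooth functions, the eigenvalue equation of [W] becomes the weak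
    equation of [weak_eigenfunction] with [l * (1 + m) = 1]. *)
Lemma eigen_mode (l : R) (S : set (R -> R)) f : 0 < l ->
  (forall a b, exists2 E, S E & [/\ smooth E,
     derive1n 4 E = (fun x => (l^-1 - 1) * E x),
     derive1n 2 E 0 = 0, derive1n 3 E 0 = 0 & E 0 = a /\ derive1 E 0 = b]) ->
  eigen_space H2 W l f ->
  exists2 E, S E /\ free_mode (l^-1 - 1) E & f = E %[ae leb01].
Proof.
move=> l0 exE ef; have [fH _] := ef.
apply: (weak_eigenfunction exE (H2_L2 fH) (weakD_L2 fH) (weakD_weak fH)).
move=> g sg; have gH := H2_smooth sg.
have := (eigen_spaceP l fH).1 ef g gH; rewrite ipH2E.
rewrite (L2_I01_ael (weakD_L2 fH) (weakD_L2 gH)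
  (L2_smooth (smooth_derive1n 2 sg)) (weakD_smooth sg)).
rewrite (I01_mulC g f) (I01_mulC (derive1n 2 g) (weakD 2 f)).
move: (I01 _) (I01 _) => p q h; apply: (mulfI (lt0r_neq0 l0)).
rewrite mulrA mulrBr mulfV ?lt0r_neq0// mulr1; lra.
Qed.

End EmbeddingOperator.

(** * The spectrum of W *)

Section Spectrum.
Context {R : realType}.
Implicit Types (f g u v : R -> R) (a b c x l : R) (j k n : nat).

Definition affine a b x : R := a + b * x.

Lemma derive1_affine a b : derive1 (affine a b) = affine b 0.
Proof.
apply: derive1_eq => x.
have d := is_deriveD (is_derive_cst a x (1 : R)) (is_deriveZ b (is_derive_id x (1 : R))).
by apply: (is_derive_congr d); rewrite /affine /GRing.scale/=; ring.
Qed.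

Lemma smooth_affine a b : smooth (affine a b).
Proof.
by apply: smooth_add; [exact: smooth_cst|apply: smooth_scale; exact: smooth_id].
Qed.

Lemma affineE0 a : affine a 0 = cst a.
Proof. by apply/funext => x; rewrite /affine mul0r addr0. Qed.

Lemma derive1n2_affine a b : derive1n 2 (affine a b) = cst 0.
Proof. by rewrite -derive1_derive1 !derive1_affine affineE0. Qed.

Lemma derive1n3_affine a b : derive1n 3 (affine a b) = cst 0.
Proof.
by rewrite -derive1_derive1n derive1n2_affine -(affineE0 0) derive1_affine.
Qed.

Lemma derive1n4_affine a b : derive1n 4 (affine a b) = fun x => 0 * affine a b x.
Proof.
rewrite -derive1_derive1n derive1n3_affine -(affineE0 0) derive1_affine.
by apply/funext => x; rewrite affineE0 mul0r.
Qed.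

Lemma free_mode_affine a b : free_mode 0 (affine a b).
Proof.
split; [exact: smooth_affine|exact: derive1n4_affine|..];
  by rewrite derive1n2_affine derive1n3_affine.
Qed.

Lemma I01_affine_mul a b c d :
  I01 (fun x => affine a b x * affine c d x) =
  a * c + (a * d + b * c) / 2 + b * d / 3.
Proof.
pose F := fun x : R => (a * c) * x + ((a * d + b * c) / 2) * (x ^+ 2)
  + (b * d / 3) * (x ^+ 3).
have dF x : is_derive x 1 F (affine a b x * affine c d x).
  have i := is_derive_id x (1 : R).
  have h := is_deriveD (is_deriveD (is_deriveZ (a * c) i)
    (is_deriveZ ((a * d + b * c) / 2) (is_deriveX 2 i)))
    (is_deriveZ (b * d / 3) (is_deriveX 3 i)).
  by apply: (is_derive_congr h); rewrite /affine /GRing.scale/=; field.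
rewrite (FTC01 dF); first by rewrite /F; field.
apply: smooth_continuous; apply: smooth_mul; exact: smooth_affine.
Qed.

Lemma eigenfun0 t : eigenfun t 0 = affine 1 0 :> (R -> R).
Proof. by rewrite affineE0. Qed.

Lemma eigenfun1 t : eigenfun t 1 = affine (- Num.sqrt 3) (2 * Num.sqrt 3) :> (R -> R).
Proof. by apply/funext => x; rewrite /eigenfun /affine addrC. Qed.

Lemma eigenfun_ge2 (t : nat -> R) k : (2 <= k)%N ->
  eigenfun t k = hyptrig (t k) 1 (- shape (t k)) 1 (- shape (t k)).
Proof.
case: k => [|[|k]]// _; apply/funext => x.
rewrite /eigenfun /hyptrig /shape; move: (_ / _) => s; ring.
Qed.

(** The eigenvalue [m] of [u'''' = m u] for the mode of index [k]. *)
Definition mode_value k : R := if (k < 2)%N then 0 else freq k ^+ 4.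

Lemma mode_value_ge0 k : 0 <= mode_value k.
Proof.
rewrite /mode_value; case: ltnP => // k2.
by rewrite exprn_ge0// ltW// freq_gt0.
Qed.

Lemma sigma2E k : sigma2 freq k = (1 + mode_value k)^-1.
Proof. by rewrite /sigma2 /mode_value; case: ifP; rewrite // addr0 invr1. Qed.

Lemma mode_value_gt0 k : (2 <= k)%N -> 0 < mode_value k.
Proof.
by move=> k2; rewrite /mode_value ltnNge k2/= exprn_gt0// freq_gt0.
Qed.

Lemma mode_value_lt j k : (j < k)%N -> (2 <= k)%N -> mode_value j < mode_value k.
Proof.
move=> jk k2; have [j2|j2] := ltnP j 2.
  by rewrite {1}/mode_value j2 mode_value_gt0.
have fjk : freq j < freq k :> R by apply: freq_lt; rewrite j2 jk.
by rewrite /mode_value (ltnNge j) (ltnNge k) j2 k2/= ltr_pXn2r// nnegrE ltW// freq_gt0.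
Qed.

Lemma mode_value_eq j k : (2 <= k)%N -> mode_value j = mode_value k -> j = k.
Proof.
move=> k2 E; apply/eqP; case: ltngtP => // jk.
  by have := mode_value_lt jk k2; rewrite E ltxx.
by have := mode_value_lt jk (leq_trans k2 (ltnW jk)); rewrite E ltxx.
Qed.

Lemma free_mode_eigenfun k : free_mode (mode_value k) (eigenfun freq k).
Proof.
case: (ltnP k 2) => k2.
  rewrite /mode_value k2; case: k k2 => [|[|//]] _.
    by rewrite eigenfun0; exact: free_mode_affine.
  by rewrite eigenfun1; exact: free_mode_affine.
rewrite (eigenfun_ge2 _ k2) /mode_value ltnNge k2/=.
have [_ cf] := @freqP R k k2; exact: free_mode_hyptrig (freq_gt0 k2) cf.
Qed.

Lemma sqrt3_sqr : Num.sqrt 3 * Num.sqrt 3 = 3 :> R.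
Proof. by rewrite -expr2 sqr_sqrtr. Qed.

Lemma eigenfun_orthonormal j k :
  I01 (fun x => eigenfun freq j x * eigenfun freq k x) = (j == k)%:R.
Proof.
have off i n : (i < n)%N ->
    I01 (fun x => eigenfun freq i x * eigenfun freq n x) = 0.
  move=> lt_in; case: (ltnP n 2) => n2.
    case: n n2 lt_in => [|[|//]] _ //; rewrite ltnS leqn0 => /eqP ->.
    by rewrite eigenfun0 eigenfun1 I01_affine_mul; field.
  apply: (free_mode_orth (free_mode_eigenfun i) (free_mode_eigenfun n)).
  by rewrite lt_eqF// mode_value_lt.
case: (ltngtP j k) => [jk|kj|->].
- by rewrite (off _ _ jk).
- by rewrite I01_mulC (off _ _ kj).
- rewrite mulr1n; case: (ltnP k 2) => k2.
    case: k k2 => [|[|//]] _.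
      by rewrite eigenfun0 I01_affine_mul; field.
    rewrite eigenfun1 I01_affine_mul.
    have := sqrt3_sqr; move: (Num.sqrt _) => s s3.
    transitivity (s * s / 3); first by field.
    by rewrite s3 divff.
  have fm := free_mode_eigenfun k.
  have [-> _] := free_mode_norm (lt0r_neq0 (mode_value_gt0 k2)) fm.
  by rewrite (eigenfun_ge2 _ k2) hyptrig0; field.
Qed.

Lemma sup_norm_le f (M : R) : (forall x, 0 <= x <= 1 -> `|f x| <= M) ->
  (sup_norm f <= M%:E)%E.
Proof.
by move=> fM; apply: ge_ereal_sup => _ [x x01 <-]; rewrite lee_fin fM.
Qed.

Lemma sup_norm_eigenfun0 : (sup_norm (eigenfun (@freq R) 0) <= 1%:E)%E.
Proof. by apply: sup_norm_le => x _; rewrite /= normr1. Qed.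

Lemma sup_norm_eigenfun1 :
  (sup_norm (eigenfun (@freq R) 1) <= (Num.sqrt 3)%:E)%E.
Proof.
apply: sup_norm_le => x /andP[x0 x1]; rewrite eigenfun1 /affine.
have s0 : 0 <= Num.sqrt 3 :> R by exact: sqrtr_ge0.
rewrite (_ : - _ + _ = Num.sqrt 3 * (2 * x - 1)); last by ring.
rewrite normrM ger0_norm// -[leRHS]mulr1 ler_wpM2l// ler_norml.
by apply/andP; split; lra.
Qed.

Lemma sup_norm_eigenfun k : (2 <= k)%N ->
  (sup_norm (eigenfun (@freq R) k) <= (Num.sqrt 6)%:E)%E.
Proof.
move=> k2; apply: sup_norm_le => x x01; rewrite (eigenfun_ge2 _ k2).
have [_ cf] := @freqP R k k2.
exact: (hyptrig_bound (freq_gt0 k2) cf (shape_freq_sqr k2) x01).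
Qed.

Variable W : (R -> R) -> (R -> R).
Hypothesis hW : adjoint H2 L2 (@embedding R) W.

Lemma eigen_eigenfun k : eigen_space H2 W (sigma2 freq k) (eigenfun freq k).
Proof.
rewrite sigma2E; apply: (free_mode_eigen hW (mode_value_ge0 k)).
exact: free_mode_eigenfun.
Qed.

(** For [l = 1] the equation is [u'''' = 0], and the conditions at 0 leave the
    affine functions. *)
Lemma eigen1_affine f : eigen_space H2 W 1 f ->
  exists a b, f = affine a b %[ae leb01].
Proof.
move=> ef; have [|E [[[a b] _ <-] _] fE] := @eigen_mode _ W hW 1
  [set affine p.1 p.2 | p in setT] f ltr01 _ ef; last by exists a, b.
move=> a b; exists (affine a b); first by exists (a, b).
split; [exact: smooth_affine|..].
- by rewrite invr1 subrr derive1n4_affine.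
- by rewrite derive1n2_affine.
- by rewrite derive1n3_affine.
- by rewrite derive1_affine /affine !mulr0 !addr0.
Qed.

(** Here [m = l ^-1 - 1] is positive, hence a fourth power; the solutions that
    satisfy the conditions at 0 are the [hyptrig t a b a b]. *)
Lemma eigen_lt1 l f : 0 < l -> l < 1 -> eigen_space H2 W l f ->
  exists t, [/\ 0 < t, l = (1 + t ^+ 4)^-1 &
    exists a, f = (fun x => a * hyptrig t 1 (- shape t) 1 (- shape t) x)
      %[ae leb01] /\ (~ char_root t -> a = 0)].
Proof.
move=> l0 l1 ef.
pose m := l^-1 - 1.
have m0 : 0 < m by rewrite subr_gt0 invf_gt1.
pose t := Num.sqrt (Num.sqrt m).
have t0 : 0 < t by rewrite !sqrtr_gt0.
have t4 : t ^+ 4 = m.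
  by rewrite -[4%N]/(2 * 2)%N exprM !sqr_sqrtr ?sqrtr_ge0// ltW.
exists t; split=> //; first by rewrite t4 /m addrC subrK invrK.
have [|E [[[a b] _ <-] fm] fE] := @eigen_mode _ W hW l
  [set hyptrig t p.1 p.2 p.1 p.2 | p in setT] f l0 _ ef.
  move=> a b.
  have [h2 h3 h4] := derive1n_hyptrig t (a / 2) (b / t / 2) (a / 2) (b / t / 2).
  exists (hyptrig t (a / 2) (b / t / 2) (a / 2) (b / t / 2)).
    by exists (a / 2, b / t / 2).
  split; [exact: smooth_hyptrig|by rewrite h4 t4|..].
  - by rewrite h2 hyptrig0 subrr.
  - by rewrite h3 hyptrig0; ring.
  - by rewrite derive1_hyptrig !hyptrig0; split; [by field|by field; rewrite lt0r_neq0].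
rewrite -/m -t4 in fm.
have [/= bE aE] := free_mode_hyptrig_inv t0 fm.
exists a; split; last exact: aE.
apply: filterS fE => x /(_ I) -> _ /=; rewrite bE /hyptrig; ring.
Qed.

Lemma independent_eigenfun n (i0 : 'I_n -> nat) (c : 'I_n -> R) :
  injective i0 ->
  (fun x => \sum_i c i * eigenfun freq (i0 i) x) = cst 0 %[ae leb01] ->
  forall i, c i = 0.
Proof.
move=> inj h i.
have sm j : smooth (eigenfun (@freq R) j).
  by have [] := free_mode_eigenfun j.
have eL j := L2_smooth (sm j).
have c0L : carrier L2 (cst 0 : R -> R) := L2_smooth (smooth_cst 0).
have sumL (s : seq 'I_n) :
    carrier L2 (fun x => \sum_(j <- s) c j * eigenfun freq (i0 j) x).
  elim: s => [|j s IH].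
    by under eq_fun do rewrite big_nil; exact: c0L.
  under eq_fun do rewrite big_cons -[X in _ + X]mul1r.
  exact: (L2_lin (c j) 1 (eL (i0 j)) IH).
have h0 := L2_I01_aer (eL (i0 i)) (sumL _) c0L h.
have sumE (s : seq 'I_n) :
    I01 (fun x => eigenfun freq (i0 i) x * \sum_(j <- s) c j * eigenfun freq (i0 j) x)
    = \sum_(j <- s) c j * (i0 i == i0 j)%:R.
  elim: s => [|j s IH].
    rewrite big_nil -[RHS](@I01_cst R); congr I01.
    by apply/funext => x; rewrite big_nil mulr0.
  rewrite big_cons -IH -eigenfun_orthonormal.
  rewrite -[X in _ + X]mul1r -(L2_I01_linr _ _ (eL _) (eL _) (sumL s)).
  congr I01.
  by apply/funext => x; rewrite big_cons mul1r.
move: h0; rewrite sumE (bigD1 i)//= eqxx mulr1 big1 ?addr0; last first.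
  move=> j ji; rewrite (_ : (i0 i == i0 j) = false) ?mulr0//.
  by apply/negbTE; apply: contra ji => /eqP /inj ->.
move=> ->; rewrite -[RHS](@I01_cst R); congr I01.
by apply/funext => x; rewrite mulr0.
Qed.

(** [W] is its own adjoint, so [eigen_space_sqr] reduces the claim to the
    eigenspaces of [W].  That for 1 is spanned by the two affine modes; that for
    another value of [sigma2] is a line; no other positive number is an
    eigenvalue. *)
Lemma singular_values_W : singular_values H2 W (sigma2 freq).
Proof.
exists W; first exact: W_adjoint.
have spos k : 0 < 1 + mode_value k.
  by rewrite ltr_pwDl// mode_value_ge0.
split.
- by move=> k; rewrite sigma2E invr_ge0 ltW.
- move=> j k; rewrite leq_eqVlt => /predU1P[->//|jk].
  rewrite !sigma2E lef_pV2 ?posrE// lerD2l.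
  have [k2|k2] := leqP 2 k; first exact/ltW/mode_value_lt.
  by rewrite /mode_value k2 (ltn_trans jk k2).
move=> l l0.
have dimE n : has_dim (eigen_space H2 W l) n ->
    has_dim (eigen_space H2 (W \o W) (l ^+ 2)) n.
  move=> [e [eE ei es]]; exists e; split => // [i|f ef].
    exact/(eigen_space_sqr hW _ l0).
  exact/es/(eigen_space_sqr hW _ l0).
have [l1|l1|l1] := ltgtP l 1.
- have [[k k2 kl]|nok] := pselect (exists2 k, (2 <= k)%N & sigma2 (@freq R) k = l).
    exists 1%N.
      rewrite (_ : [set _ | _] = [set k]); first exact: card_set1.
      apply/seteqP; split=> [j /=|_ -> //]; rewrite -kl !sigma2E => /invr_inj.
      by move=> /addrI /mode_value_eq; apply.
    apply: dimE; exists (fun=> eigenfun freq k); split.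
    - by move=> _; rewrite -kl; exact: eigen_eigenfun.
    - move=> c h; apply: (@independent_eigenfun 1 (fun=> k) c _ h).
      by move=> i j _; rewrite !ord1.
    - move=> f ef; have [t [t0 lE [a [fa _]]]] := eigen_lt1 l0 l1 ef.
      have tk : t = freq k.
        apply/eqP; rewrite -(@eqrXn2 _ 4) ?ltW ?freq_gt0//; apply/eqP.
        apply: (addrI 1); apply: invr_inj; rewrite -lE -kl sigma2E.
        by rewrite /mode_value ltnNge k2.
      exists (fun=> a); apply: filterS fa => x /(_ I) -> _.
      by rewrite big_ord1 (eigenfun_ge2 _ k2) tk.
  exists 0%N.
    rewrite (_ : [set _ | _] = set0); first by rewrite II0.
    apply/seteqP; split=> // k /= kl; apply: nok; exists k => //.
    rewrite leqNgt; apply/negP => k2; move: kl; rewrite /sigma2 k2 => kl.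
    by rewrite -kl ltxx in l1.
  apply: dimE; exists (fun=> cst 0); split => [[]//|c _ []//|f ef].
  exists (fun=> 0); have [t [t0 lE [a [fa a0]]]] := eigen_lt1 l0 l1 ef.
  apply: filterS fa => x /(_ I) -> _; rewrite big_ord0 a0 ?mul0r// => ct.
  apply: nok; have [k k2 kt] : [set freq k | k in [set k | (2 <= k)%N]] t.
    by rewrite freq_range.
  exists k => //; by rewrite lE sigma2E /mode_value ltnNge k2/= kt.
- exists 0%N.
    rewrite (_ : [set _ | _] = set0); first by rewrite II0.
    apply/seteqP; split=> // k /= kl; move: l1; rewrite -kl sigma2E ltNge.
    by rewrite invf_le1 ?lerDl ?mode_value_ge0.
  apply: dimE; exists (fun=> cst 0); split => [[]//|c _ []//|f ef].
  exists (fun=> 0); apply: filterS (eigen_gt1 hW l1 ef) => x /(_ I) -> _.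
  by rewrite big_ord0.
- exists 2%N.
    rewrite (_ : [set _ | _] = `I_2) ?card_eqxx//.
    apply/seteqP; split=> k /=; rewrite l1.
      rewrite sigma2E leqNgt => h; apply/negP => k2.
      have := mode_value_gt0 (k2 : (2 <= k)%N); move/eqP: h.
      by rewrite invr_eq1 => /eqP; rewrite -[X in _ = X]addr0 => /addrI ->; rewrite ltxx.
    by rewrite /sigma2 => ->.
  apply: dimE; exists (fun i : 'I_2 => eigenfun freq i); split.
  - move=> i; have := eigen_eigenfun i; rewrite /sigma2 ltn_ord l1; exact.
  - by move=> c h; exact: (@independent_eigenfun 2 _ c val_inj h).
  - move=> f ef; rewrite l1 in ef; have [a [b fab]] := eigen1_affine ef.
    exists (fun i => if i == 0%N :> nat then a + b / 2 else b / (2 * Num.sqrt 3)).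
    apply: filterS fab => x /(_ I) -> _.
    rewrite 2!big_ord_recl big_ord0 addr0 eigenfun0 eigenfun1 /= /affine.
    by field; rewrite gt_eqF// sqrtr_gt0.
Qed.

End Spectrum.

Theorem theorem4p2 (R : realType) (Idstar : (R -> R) -> (R -> R))
    (hIdstar : adjoint H2 L2 embedding Idstar) :
  let W := Idstar \o embedding in
  exists t : nat -> R,
    [/\ forall j k, (2 <= j < k)%N -> t j < t k,
        [set t k | k in [set k | (2 <= k)%N]] =
          [set x | 0 < x /\ cosh x * cos x = 1],
        singular_values H2 W (sigma2 t),
        forall k, eigen_space H2 W (sigma2 t k) (eigenfun t k) &
        (forall j k, inner L2 (eigenfun t j) (eigenfun t k) = (j == k)%:R) /\
        [/\ (sup_norm (eigenfun t 0%N) <= 1%:E)%E,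
            (sup_norm (eigenfun t 1%N) <= (Num.sqrt 3)%:E)%E &
            forall k, (2 <= k)%N ->
              (sup_norm (eigenfun t k) <= (Num.sqrt 6)%:E)%E]].
Proof.
move=> W; exists freq; split.
- exact: freq_lt.
- exact: freq_range.
- exact: (singular_values_W hIdstar).
- exact: (eigen_eigenfun hIdstar).
split; first by move=> j k; rewrite innerL2E eigenfun_orthonormal.
split; [exact: sup_norm_eigenfun0|exact: sup_norm_eigenfun1|].
exact: sup_norm_eigenfun.
Qed.
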